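(* Let $\mathscr A=\{a_1,a_2,\ldots\}$, with $a_1<a_2<\cdots$, be a weakly subconvex $L^p$-set with $1\leq p<2$. Let $k\geq2$, let $(\alpha_0,\ldots,\alpha_k)\in\mathbb R^{k+1}$ and $\psi(x)=\alpha_kx^k+\cdots+\alpha_1x+\alpha_0$. Suppose that at least one of $\alpha_2,\ldots,\alpha_k$ is of finite Diophantine type. Then $(\psi(a_n))_{n=1}^\infty$ is equidistributed modulo $1$.
   Context: For $\mathscr A\subseteq\mathbb N$ write $\mathscr A(N)=\mathscr A\cap[1,N]$, $A(N)=\mathrm{card}(\mathscr A(N))$, $e(z)=e^{2\pi iz}$, $I_p(N;\mathscr A)=\int_0^1|\sum_{n\in\mathscr A(N)}e(n\alpha)|^p\,d\alpha$. A non-empty $\mathscr A\subseteq\mathbb N$ is a weakly subconvex $L^p$-set if $0<p<2$ and for every $\varepsilon>0$ and all $N$ large in terms of $p,\varepsilon$, $I_p(N;\mathscr A)\ll N^{\varepsilon-1}A(N)^p$. A real $\theta$ is of finite Diophantine type if there is $k\in\mathbb N$ with $\liminf_{q\to\infty}q^k\|q\theta\|>0$, $\|x\|$ being the distance to the nearest integer. A sequence $(s_n)$ is equidistributed modulo 1 if for all $0\leq a<b\leq1$, $\lim_{N\to\infty}N^{-1}\mathrm{card}\{n\leq N:a\leq\{s_n\}\leq b\}=b-a$. *)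

(* Defs.v *)
From mathcomp Require Import all_boot all_order all_algebra.
From mathcomp Require Import complex.
From mathcomp Require Import all_classical all_reals all_analysis.

Set Implicit Arguments.
Unset Strict Implicit.
Unset Printing Implicit Defensive.

Import Order.TTheory GRing.Theory Num.Theory.
Import numFieldNormedType.Exports.
Local Open Scope classical_set_scope.
Local Open Scope ring_scope.

(* e(x) = exp(2 pi i x) for real x, via Euler's formula *)
Definition expi2pi (R : realType) (x : R) : R[i] :=
  (cos (2 * pi * x) +i* sin (2 * pi * x))%C.

(* A `&` [1, N], as a finite set *)
Definition initial (A : set nat) (N : nat) : {set 'I_N.+1} :=
  [set n : 'I_N.+1 | (0 < n)%N && (nat_of_ord n \in A)]%SET.

Definition expsum (R : realType) (A : set nat) (N : nat) (x : R) : R[i] :=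
  \sum_(n in initial A N) expi2pi (n%:R * x).

(* The norm of R[i] takes its (real) values in R[i]; complex.Re brings it
   back to R. *)
Definition mean_value (R : realType) (p : R) (A : set nat) (N : nat) : R :=
  \int[lebesgue_measure]_(x in `[0, 1]) ((complex.Re `|expsum A N x|) `^ p).

(* The implicit constant in << may depend on p, eps and A.  Here the
   natural numbers start at 1, hence the clause ~ A 0. *)
Definition weakly_subconvex (R : realType) (p : R) (A : set nat) : Prop :=
  [/\ 0 < p < 2, A !=set0, ~ A 0%N &
    forall eps : R, 0 < eps -> exists C : R, \forall N \near \oo,
      mean_value p A N <= C * (N%:R `^ (eps - 1) * #|initial A N|%:R `^ p)].

Definition dist_int (R : realType) (x : R) : R :=
  inf [set `|x - m%:~R| | m in [set: int]].

Definition finite_diophantine_type (R : realType) (theta : R) : Prop :=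
  exists2 k : nat, (0 < k)%N &
    (0 < limn_einf (fun q : nat => (q%:R ^+ k * dist_int (q%:R * theta))%:E))%E.

Definition fractional_part (R : realType) (x : R) : R := x - (Num.floor x)%:~R.

(* Sequences are indexed from 0: s n stands for the term s_{n+1} of a
   sequence (s_n)_{n >= 1}, and the first
   N terms are the s n with n < N. *)
Definition equidistributed_mod1 (R : realType) (s : nat -> R) : Prop :=
  forall a b : R, 0 <= a -> a < b -> b <= 1 ->
    (N%:R^-1 *
       #|[set n : 'I_N | a <= fractional_part (s n) <= b]%SET|%:R) @[N --> \oo]
      --> b - a.

(* Main.v *)
Require Import Defs.
From mathcomp Require Import all_boot all_order all_algebra.
From mathcomp Require Import complex.
From mathcomp Require Import all_classical all_reals all_analysis.
From mathcomp Require Import measurable_realfun zify ring lra.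
Import Order.TTheory GRing.Theory Num.Theory.
Import numFieldNormedType.Exports.
Set Implicit Arguments.
Unset Strict Implicit.
Unset Printing Implicit Defensive.
Local Open Scope ring_scope.

(* By orthogonality, the sum of e(h psi(n)) over n in A(N) is the integral over
   [0, 1] of f g, with f(x) the sum of e(n x) over A(N) and g(x) the sum of
   e(h psi(m) - m x) over all m <= N.  For any Y > 0 and G >= sup |g|,
     |f g| <= Y^(1-p) G^(2-p) |f|^p + Y |g|^2,
   as one sees by comparing |f| with Y |g|.  The second term integrates to
   Y (N + 1) by Parseval, and Y = eta A(N) / (N + 1) makes it negligible.  The
   first is then controlled by subconvexity, which only loses N^eps, and by a
   power saving sup |g| <= N^(1-s), uniform in the linear coefficient.

   The power saving is Weyl's inequality in its inverse form: if the sum of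
   e(P(n)) over n < N is at least N / D, then one q <= D^c brings every q P_i,
   i >= 2, within D^c / N^i of an integer.  For the leading coefficient this is
   an induction on the degree by van der Corput differencing and a lemma of
   Vinogradov on dense sets of h with h theta near an integer.  Once the
   coefficients above the j-th one are approximated with denominator q, they
   contribute an almost constant phase on short progressions of step q, which
   leaves a polynomial of degree j.  A coefficient of finite type does not allow
   such a q when D is a small power of N.

   Equidistribution follows from the decay of the exponential sums by averaging
   translates of the Fejer kernel over multiples of 1 / L. *)

(** * Exponential sums *)

Section Exponential.
Variable R : realType.
Implicit Types (x y : R) (z w : R[i]) (f : nat -> R).

(** The real-valued modulus, in the form in which it occurs in [mean_value]. *)
Definition cabs z : R := complex.Re `|z|.

Lemma cabsE z : cabs z = Num.sqrt (complex.Re z ^+ 2 + complex.Im z ^+ 2).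
Proof. by rewrite /cabs normc_def. Qed.

Lemma sqr_cabs z : cabs z ^+ 2 = complex.Re z ^+ 2 + complex.Im z ^+ 2.
Proof. by rewrite cabsE sqr_sqrtr // addr_ge0 ?sqr_ge0. Qed.

Lemma cabs_ge0 z : 0 <= cabs z.
Proof. by rewrite cabsE sqrtr_ge0. Qed.

Lemma cabs0 : cabs 0 = 0.
Proof. by rewrite /cabs normr0. Qed.

Lemma cabsN z : cabs (- z) = cabs z.
Proof. by rewrite /cabs normrN. Qed.

Lemma cabsM z w : cabs (z * w) = cabs z * cabs w.
Proof. by rewrite /cabs normrM !normc_def /= mul0r subr0. Qed.

Lemma cabsD z w : cabs (z + w) <= cabs z + cabs w.
Proof.
by have := ler_normD z w; rewrite !normc_def -rmorphD/= lecR !cabsE.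
Qed.

Lemma cabsB z w : cabs (z - w) <= cabs z + cabs w.
Proof. by rewrite -(cabsN w) cabsD. Qed.

Lemma cabs_sum (I : Type) (r : seq I) (P : pred I) (F : I -> R[i]) :
  cabs (\sum_(i <- r | P i) F i) <= \sum_(i <- r | P i) cabs (F i).
Proof.
elim/big_ind2: _ => [|z1 x1 z2 x2 h1 h2|//]; first by rewrite cabs0.
by rewrite (le_trans (cabsD _ _)) // lerD.
Qed.

Lemma Re_le_cabs z : `|complex.Re z| <= cabs z.
Proof. by rewrite cabsE -sqrtr_sqr ler_wsqrtr // lerDl sqr_ge0. Qed.

Lemma expi2piD x y : expi2pi (x + y) = expi2pi x * expi2pi y.
Proof. by rewrite /expi2pi mulrDr cosD sinD; congr Complex; rewrite addrC. Qed.

Lemma expi2pi0 : expi2pi (0 : R) = 1.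
Proof. by rewrite /expi2pi mulr0 cos0 sin0. Qed.

Lemma cabs_expi2pi x : cabs (expi2pi x) = 1.
Proof. by rewrite cabsE /= cos2Dsin2 sqrtr1. Qed.

Lemma expi2pi1 : expi2pi (1 : R) = 1.
Proof. by rewrite /expi2pi mulr1 mulr_natl cos2pi sin2pi. Qed.

Lemma expi2piN x : expi2pi x * expi2pi (- x) = 1.
Proof. by rewrite -expi2piD subrr expi2pi0. Qed.

Lemma expi2pi_nat n : expi2pi (n%:R : R) = 1.
Proof.
by elim: n => [|n IH]; rewrite ?expi2pi0// -natr1 expi2piD IH expi2pi1 mulr1.
Qed.

Lemma expi2pi_int (m : int) : expi2pi (m%:~R : R) = 1.
Proof.
case: m => n; first exact: expi2pi_nat.
by rewrite NegzE mulrNz; have := expi2piN n.+1%:R; rewrite expi2pi_nat mul1r.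
Qed.

Lemma expi2piDint x (m : int) : expi2pi (x + m%:~R) = expi2pi x.
Proof. by rewrite expi2piD expi2pi_int mulr1. Qed.

Lemma expi2pi_subC x y :
  complex.Re (expi2pi (x - y)) = complex.Re (expi2pi (y - x)).
Proof. by rewrite /= -cosN -mulrN opprB. Qed.

Lemma Re_sum (I : Type) (r : seq I) (P : pred I) (F : I -> R[i]) :
  complex.Re (\sum_(i <- r | P i) F i) = \sum_(i <- r | P i) complex.Re (F i).
Proof. by elim/big_rec2: _ => // i x z _ <-; case: z (F i) => ? ? []. Qed.

Lemma Im_sum (I : Type) (r : seq I) (P : pred I) (F : I -> R[i]) :
  complex.Im (\sum_(i <- r | P i) F i) = \sum_(i <- r | P i) complex.Im (F i).
Proof. by elim/big_rec2: _ => // i x z _ <-; case: z (F i) => ? ? []. Qed.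

Lemma sqr_cabs_sum (I : Type) (r : seq I) (P : pred I) (F : I -> R) :
  cabs (\sum_(i <- r | P i) expi2pi (F i)) ^+ 2 =
  \sum_(i <- r | P i) \sum_(j <- r | P j) complex.Re (expi2pi (F i - F j)).
Proof.
rewrite sqr_cabs Re_sum Im_sum !expr2 !mulr_suml -big_split/=.
apply: eq_bigr => i _; rewrite !mulr_sumr -big_split/=.
by apply: eq_bigr => j _; rewrite mulrBr cosB.
Qed.

Lemma cabs_expi2piB1 x : cabs (expi2pi x - 1) ^+ 2 = 2 - 2 * cos (2 * pi * x).
Proof.
rewrite sqr_cabs/= subr0; have := cos2Dsin2 (2 * pi * x).
move: (cos _) (sin _) => c s h; lra.
Qed.

Lemma sin_le_norm x : `|sin x| <= `|x|.
Proof.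
wlog x0 : x / 0 < x => [h|].
  have [x0|x0|->] := ltgtP x 0; last by rewrite sin0 normr0.
    by rewrite -normrN -sinN -(normrN x) h // oppr_gt0.
  exact: h.
have [|c _] := @MVT R sin cos 0 x x0 (fun y _ => is_derive_sin y).
  by apply: continuous_subspaceT; exact: continuous_sin.
by rewrite sin0 !subr0 => ->; rewrite normrM ler_piMl//; exact: cos_max.
Qed.

(** Since |e(x) - 1| = 2 |sin(pi x)|, the constant 2 pi works; [pi < 4] rounds it to 8. *)
Lemma cabs_expi2piB1_le x : cabs (expi2pi x - 1) <= 8 * `|x|.
Proof.
rewrite -(@ler_pXn2r _ 2) ?nnegrE ?cabs_ge0 ?mulr_ge0// cabs_expi2piB1.
have -> : 2 * pi * x = (pi * x) *+ 2 by rewrite mulr2n; ring.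
rewrite cos_mulr2n cos2sin2 -mulr_natl.
have h := sin_le_norm (pi * x).
have : sin (pi * x) ^+ 2 <= (pi * x) ^+ 2.
  by rewrite -[leLHS]real_normK ?num_real// -[leRHS]real_normK ?num_real// ler_sqr.
have p0 := pi_gt0 R.
have p4 : (pi : R) < 4 by have := pihalf_lt2 R; lra.
rewrite [(8 * _) ^+ 2]exprMn real_normK ?num_real//.
have : (pi * x) ^+ 2 <= 16 * x ^+ 2.
  have -> : 16 = 4 ^+ 2 :> R by ring.
  by rewrite exprMn ler_wpM2r ?sqr_ge0// ler_sqr ?nnegrE; lra.
lra.
Qed.

Lemma cabs_expi2pi_sub x y : cabs (expi2pi x - expi2pi y) <= 8 * `|x - y|.
Proof.
rewrite -[x in expi2pi x](subrK y) expi2piD -[X in _ - X]mul1r -mulrBl cabsM.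
by rewrite cabs_expi2pi mulr1 cabs_expi2piB1_le.
Qed.

Lemma cabs_expi2piB1_mul x n : cabs (expi2pi (n%:R * x) - 1) <=
  n%:R * cabs (expi2pi x - 1).
Proof.
elim: n => [|n IH]; first by rewrite !mul0r expi2pi0 subrr cabs0.
rewrite -natr1 !mulrDl !mul1r expi2piD.
have -> : expi2pi (n%:R * x) * expi2pi x - 1 =
  (expi2pi (n%:R * x) - 1) * expi2pi x + (expi2pi x - 1) by ring.
by rewrite (le_trans (cabsD _ _))// cabsM cabs_expi2pi mulr1 lerD2r.
Qed.

Lemma cos_le0_pihalf x : pi / 2 <= x <= pi -> cos x <= 0.
Proof.
move=> /andP[h1 h2]; have := @cosDpi R (x - pi); rewrite subrK => ->.
rewrite oppr_le0 cos_ge0_pihalf//; have := pi_gt0 R; lra.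
Qed.

(* Multiplying x by a suitable n brings its distance to the nearest integer
   into [1/4, 1/2], where |e(nx) - 1| >= 1. *)
Lemma cabs_expi2piB1_ge x : `|x| <= 1 / 2 -> 2 * `|x| <= cabs (expi2pi x - 1).
Proof.
wlog x0 : x / 0 < x => [h hx|].
  have [x0|x0|->] := ltgtP x 0; last by rewrite normr0 mulr0 cabs_ge0.
    have -> : expi2pi x - 1 = - (expi2pi x * (expi2pi (- x) - 1)).
      by rewrite mulrBr expi2piN; ring.
    by rewrite cabsN cabsM cabs_expi2pi mul1r -normrN h ?oppr_gt0// normrN.
  exact: h.
rewrite gtr0_norm// => hx.
have [n hn] : exists n : nat, 1 / 4 <= n%:R * x <= 1 / 2.
  have [h|h] := lerP (1/4) x; first by exists 1%N; lra.
  (* Here n x <= 1/2 < (n + 1) x, and x < 1/4 leaves n x > 1/4. *)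
  pose n := Num.truncn ((2 * x)^-1); exists n.
  have /truncn_itv : 0 <= (2 * x)^-1 by rewrite invr_ge0 mulr_ge0 // ltW.
  rewrite -/n => /andP[h1 h2].
  have e : (2 * x)^-1 * x = 1 / 2 by field; rewrite gt_eqF.
  have : n%:R * x <= (2 * x)^-1 * x by rewrite ler_pM2r.
  have : (2 * x)^-1 * x < n.+1%:R * x by rewrite ltr_pM2r.
  rewrite e -[n.+1%:R]natr1 mulrDl; lra.
have n0 : 0 < n%:R :> R.
  by rewrite ltr0n lt0n; apply: contraTneq hn => ->; rewrite mul0r; lra.
have h : 1 <= cabs (expi2pi (n%:R * x) - 1).
  rewrite -(@ler_pXn2r _ 2) ?nnegrE ?cabs_ge0// cabs_expi2piB1 expr1n.
  have := @cos_le0_pihalf (2 * pi * (n%:R * x)).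
  have hp := pi_gt0 R.
  have : pi / 2 <= 2 * pi * (n%:R * x) <= pi by nra.
  move=> hh /(_ hh); lra.
(* n (2 x) <= 1 <= |e(n x) - 1| <= n |e(x) - 1|. *)
rewrite -(ler_pM2l n0); apply: le_trans (cabs_expi2piB1_mul _ _).
by apply: le_trans h; lra.
Qed.

Definition nint x : int := Num.floor (x + 1 / 2).

Lemma nintP x : `|x - (nint x)%:~R| <= 1 / 2.
Proof.
have := floor_itv (x + 1/2); rewrite -/(nint x) intrD => /andP[h1 h2].
by rewrite ler_norml; lra.
Qed.

(** Not divided by e(x) - 1, so that integral [x] needs no separate case. *)
Lemma geometric_expi2pi x y N :
  (expi2pi x - 1) * \sum_(n < N) expi2pi (x * n%:R + y) =
  expi2pi (x * N%:R + y) - expi2pi y.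
Proof.
elim: N => [|N IH]; first by rewrite big_ord0 !mulr0 add0r subrr.
rewrite big_ord_recr/= mulrDr IH -natr1 mulrDr mulr1.
have -> : x * N%:R + x + y = x + (x * N%:R + y) by ring.
by rewrite [expi2pi (x + _)]expi2piD; ring.
Qed.

Lemma cabs_geometric x y N :
  cabs (expi2pi x - 1) * cabs (\sum_(n < N) expi2pi (x * n%:R + y)) <= 2.
Proof.
rewrite -cabsM geometric_expi2pi (le_trans (cabsB _ _))// !cabs_expi2pi; lra.
Qed.

Lemma cabs_geometric_le x y N :
  `|x - (nint x)%:~R| * cabs (\sum_(n < N) expi2pi (x * n%:R + y)) <= 1.
Proof.
have h : 2 * `|x - (nint x)%:~R| <= cabs (expi2pi x - 1).
  rewrite (le_trans (cabs_expi2piB1_ge (nintP x)))//.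
  by rewrite -mulrNz expi2piDint.
have := cabs_geometric x y N.
have : 2 * `|x - (nint x)%:~R| * cabs (\sum_(n < N) expi2pi (x * n%:R + y)) <=
 cabs (expi2pi x - 1) * cabs (\sum_(n < N) expi2pi (x * n%:R + y)).
  by rewrite ler_wpM2r ?cabs_ge0.
lra.
Qed.

Lemma cabs_sum_expi2pi_le f N : cabs (\sum_(n < N) expi2pi (f n)) <= N%:R.
Proof.
rewrite (le_trans (cabs_sum _ _ _))// (eq_bigr (fun=> 1)) => [|i _].
  by rewrite sumr_const card_ord.
by rewrite cabs_expi2pi.
Qed.

(** Group the pairs in the expanded square by their difference: the diagonal gives N, and each pair
    at distance h + 1 occurs twice, with conjugate terms. Before absolute values are taken this is
    an identity, proved by induction on [N]. *)
Lemma van_der_corput f N :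
  cabs (\sum_(n < N) expi2pi (f n)) ^+ 2 <= N%:R + 2 * \sum_(h < N)
    cabs (\sum_(n < N - h.+1) expi2pi (f (n + h.+1)%N - f n)).
Proof.
apply: (@le_trans _ _ (N%:R + 2 * \sum_(h < N) \sum_(n < N - h.+1)
    complex.Re (expi2pi (f (n + h.+1)%N - f n)))); last first.
  rewrite lerD2l ler_pM2l//; apply: ler_sum => h _.
  by rewrite -Re_sum (le_trans (ler_norm _))// Re_le_cabs.
rewrite le_eqVlt; apply/orP; left; apply/eqP.
elim: N => [|N IH].
  by rewrite !big_ord0 cabs0 expr0n mulr0 addr0.
rewrite sqr_cabs_sum big_ord_recr/=.
under eq_bigr => i _ do rewrite big_ord_recr/=.
rewrite big_split/= -sqr_cabs_sum {}IH [in LHS]big_ord_recr/=.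
rewrite subrr mulr0 cos0 [in RHS]big_ord_recr/= subnn big_ord0 addr0.
have -> : \sum_(i < N) cos (2 * pi * (f N - f i)) =
          \sum_(i < N) cos (2 * pi * (f i - f N)) :> R.
  by apply: eq_bigr => i _; exact: expi2pi_subC.
(* Passing from N to N + 1 adds one pair to each shift, the one ending at N; reversing the order of
   the shifts lists these pairs by their first index. *)
have -> : \sum_(i < N) \sum_(n < N.+1 - i.+1)
     cos (2 * pi * (f (n + i.+1)%N - f n)) =
   \sum_(i < N) \sum_(n < N - i.+1) cos (2 * pi * (f (n + i.+1)%N - f n)) +
   \sum_(i < N) cos (2 * pi * (f i - f N)) :> R.
  rewrite -[X in _ = _ + X](big_mkord xpredT (fun i => cos (2 * pi * (f i - f N)))).
  rewrite big_nat_rev big_mkord -big_split/=; apply: eq_bigr => i _.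
  rewrite subSn// big_ord_recr/= add0n; congr (_ + _).
  rewrite -[LHS]expi2pi_subC/= subnK//.
by rewrite -natr1; ring.
Qed.

End Exponential.

(** * Vinogradov's lemma *)

Section PolynomialShift.
Variable R : comNzRingType.
Implicit Types (P : {poly R}) (q u h : R).

Lemma size_affine_exp q u n : (size ((q *: 'X + u%:P) ^+ n)%R <= n.+1)%N.
Proof.
apply: leq_trans (size_poly_exp_leq _ _) _; rewrite ltnS.
apply: (@leq_trans (1 * n)%N); last by rewrite mul1n.
rewrite leq_mul2r; apply/orP; right; rewrite -ltnS.
have h : (size (q *: 'X + u%:P)%R <= 2)%N.
  apply: leq_trans (size_polyD _ _) _; rewrite geq_max.
  rewrite (leq_trans (size_scale_leq _ _)) ?size_polyX//.
  by rewrite (leq_trans (size_polyC_leq1 _)).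
by case: (size _) h.
Qed.

Lemma coef_affine_exp q u n : ((q *: 'X + u%:P) ^+ n)`_n = q ^+ n.
Proof.
elim: n => [|n IH]; first by rewrite !expr0 coefC.
rewrite exprS mulrDl coefD -scalerAl coefZ coefXM/= IH coefCM exprS.
by rewrite [X in u * X]nth_default ?size_affine_exp// mulr0 addr0.
Qed.

(** Only the term of degree n reaches degree n. As [n] may exceed the degree of [P], size bounds
    follow as well. *)
Lemma coef_comp_affine P q u n : (size P <= n.+1)%N ->
  (P \Po (q *: 'X + u%:P))`_n = P`_n * q ^+ n.
Proof.
move=> sP; rewrite /comp_poly (@horner_coef_wide _ n.+1) ?size_map_polyC//.
rewrite coef_sum big_ord_recr/= big1 ?add0r => [|i _].
  by rewrite coef_map/= coefCM coef_affine_exp.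
rewrite coef_map/= coefCM [X in _ * X]nth_default ?mulr0//.
by apply: leq_trans (size_affine_exp _ _ _) _.
Qed.

Lemma size_comp_affine P q u : (size (P \Po (q *: 'X + u%:P))%R <= size P)%N.
Proof.
apply/leq_sizeP => j hj; rewrite (coef_comp_affine _ _ (leqW hj)).
by rewrite nth_default ?mul0r.
Qed.

Lemma coef_XaddC_exp h n : (('X + h%:P) ^+ n.+1)`_n = n.+1%:R * h.
Proof.
have hX m : (('X + h%:P) ^+ m)`_m = 1.
  by have := coef_affine_exp 1 h m; rewrite scale1r expr1n.
elim: n => [|n IH].
  by rewrite expr1 mul1r coefD coefX coefC add0r.
rewrite exprS mulrDl coefD coefXM/= IH coefCM hX mulr1.
by rewrite -[n.+2%:R]natr1 mulrDl mul1r.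
Qed.

Definition poly_diff P h := P \Po ('X + h%:P) - P.

Lemma size_poly_diff P h n : (size P <= n.+1)%N -> (size (poly_diff P h) <= n)%N.
Proof.
move=> sP; apply/leq_sizeP => j hj; rewrite coefB.
have sPj : (size P <= j.+1)%N by rewrite (leq_trans sP).
have := coef_comp_affine 1 h sPj.
by rewrite scale1r expr1n mulr1 => ->; rewrite subrr.
Qed.

(** Split off the term of degree n + 1: the difference of the rest has too low a degree to
    contribute, and the binomial expansion of this term gives the factor (n + 1) h. *)
Lemma coef_poly_diff P h n : (size P <= n.+2)%N ->
  (poly_diff P h)`_n = n.+1%:R * h * P`_n.+1.
Proof.
move=> sP; set c := P`_n.+1; pose Q := P - c *: 'X^(n.+1).
have sQ : (size Q <= n.+1)%N.
  apply/leq_sizeP => j; rewrite leq_eqVlt => /predU1P[<-|hj].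
    by rewrite coefB coefZ coefXn eqxx mulr1 subrr.
  by rewrite coefB coefZ coefXn gtn_eqF// mulr0 subr0 nth_default// (leq_trans sP).
have -> : P = Q + c *: 'X^(n.+1) by rewrite subrK.
have -> : poly_diff (Q + c *: 'X^(n.+1)) h =
    poly_diff Q h + c *: (('X + h%:P) ^+ n.+1 - 'X^(n.+1)).
  rewrite /poly_diff comp_polyD comp_polyZ comp_Xn_poly scalerBr.
  by rewrite opprD addrACA.
rewrite coefD [X in X + _]nth_default ?size_poly_diff// add0r coefZ coefB.
by rewrite coef_XaddC_exp coefXn ltn_eqF// subr0 mulrC.
Qed.

Lemma horner_poly_diff P h x : (poly_diff P h).[x] = P.[x + h] - P.[x].
Proof. by rewrite /poly_diff hornerD hornerN horner_comp !hornerE. Qed.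

End PolynomialShift.

Lemma card_le_inj (T : finType) (H : {set T}) (f : T -> nat) K :
  (forall x, x \in H -> (f x < K)%N) -> {in H &, injective f} -> (#|H| <= K)%N.
Proof.
move=> hf finj; case: K hf => [|K] hf.
  by rewrite leqn0 cards_eq0; apply/eqP/setP => x; rewrite inE; apply/negP => /hf.
rewrite -(card_ord K.+1) -(@card_in_imset _ _ (fun x => inord (f x) : 'I_K.+1)).
  exact: max_card.
move=> x y xH yH /(congr1 val); rewrite /= !inordK ?hf// => e.
exact: finj.
Qed.

(** * Reals close to an integer, and dense sets of multiples *)

Section NearInteger.
Variable R : realType.
Implicit Types (x y theta kappa : R).

(** Existential form of ||x|| <= kappa: integer witnesses can be added and scaled explicitly. *)
Definition near_int x kappa := exists m : int, `|x - m%:~R| <= kappa.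

Lemma near_int_le x k1 k2 : k1 <= k2 -> near_int x k1 -> near_int x k2.
Proof. by move=> h [m hm]; exists m; exact: le_trans h. Qed.

Lemma near_int_half x : near_int x (1 / 2).
Proof. by exists (nint x); exact: nintP. Qed.

Lemma near_int_mul (n : nat) x k : near_int x k -> near_int (n%:R * x) (n%:R * k).
Proof.
move=> [m hm]; exists (n%:Z * m).
rewrite intrM -mulrBr normrM normr_nat ler_wpM2l//.
Qed.

(* Two elements of H differ by some q <= 2 E, and then t := ||q theta|| is at
   most 2 kappa.  For 2 kappa < m t <= 1 / 2 two elements of H cannot differ by
   q m, so that H has at most q (2 kappa / t + 1) elements in each interval of
   length about q / (2 t).  As H is dense, this bounds t by kappa / N up to a
   factor depending on E. *)
Lemma vinogradov theta kappa (N E : nat) (H : {set 'I_N}) :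
  (0 < E)%N -> (2 * E < N)%N -> (N <= E * #|H|)%N -> 32 * E%:R * kappa <= 1 ->
  (forall h, h \in H -> near_int (h.+1%:R * theta) kappa) ->
  exists2 q : nat, (0 < q <= 2 * E)%N &
    near_int (q%:R * theta) (16 * E%:R ^+ 2 * kappa / N%:R).
Proof.
move=> E0 EN NH kap hH.
have near_sub (x y : 'I_N) : x \in H -> y \in H -> (x < y)%N ->
    near_int ((y - x)%:R * theta) (2 * kappa).
  move=> /hH[m hm] /hH[n hn] xy; exists (n - m); move: hm hn.
  rewrite -[x.+1%:R]natr1 -[y.+1%:R]natr1 natrB 1?ltnW// intrD mulrNz !mulrDl mulNr.
  move: (x%:R * theta) (y%:R * theta) m%:~R n%:~R => u v m' n'.
  by rewrite !ler_norml; lra.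
have kap0 : 0 <= kappa.
  have /card_gt0P[x /hH[m]] : (0 < #|H|)%N.
    by rewrite lt0n; apply: contraTneq NH => ->; rewrite muln0 -ltnNge; lia.
  exact: le_trans.
(* Otherwise each block of length 2 E meets [H] at most once, so E |H| <= N / 2 + E < N. *)
have [x [y [xH yH xy yx]]] : exists x y : 'I_N,
    [/\ x \in H, y \in H, (x < y)%N & (y - x < 2 * E)%N].
  apply: contrapT => no.
  have : (#|H| <= (N %/ (2 * E)).+1)%N.
    apply: (@card_le_inj _ H (fun x : 'I_N => x %/ (2 * E))%N) => [x _|x y xH yH e].
      by rewrite ltnS leq_div2r// ltnW.
    have hx := divn_eq x (2 * E); have hy := divn_eq y (2 * E).
    have mx : (x %% (2 * E) < 2 * E)%N by rewrite ltn_mod; lia.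
    have my : (y %% (2 * E) < 2 * E)%N by rewrite ltn_mod; lia.
    rewrite e in hx; apply/val_inj/eqP => /=; case: ltngtP => // h.
      by case: no; exists x, y; split=> //; lia.
    by case: no; exists y, x; split=> //; lia.
  have h := leq_trunc_div N (2 * E).
  move: (N %/ (2 * E))%N h => k h1 h2; nia.
set q := (y - x)%N in yx *; have q0 : (0 < q)%N by rewrite subn_gt0.
have [a ha] := near_sub _ _ xH yH xy; rewrite -/q in ha.
set t := `|q%:R * theta - a%:~R| in ha.
exists q; first by rewrite q0 ltnW.
have t0 : 0 <= t by rewrite normr_ge0.
exists a; rewrite -/t; have [->|tn0] := eqVneq t 0.
  by rewrite !mulr_ge0// ?invr_ge0// sqr_ge0.
have {tn0}t0 : 0 < t by rewrite lt_def tn0.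
have E1 : 1 <= E%:R :> R by rewrite ler1n.
have kap32 : 32 * kappa <= 1 by nra.
(* For m1 < m <= m2 one has 2 kappa < m t <= 1/2. *)
pose m1 := Num.truncn (2 * kappa / t); pose m2 := Num.truncn ((2 * t)^-1).
have /truncn_itv/andP[m1le m1gt] : 0 <= 2 * kappa / t by rewrite divr_ge0 ?mulr_ge0// ltW.
have /truncn_itv/andP[m2le m2gt] : 0 <= (2 * t)^-1 by rewrite invr_ge0 mulr_ge0// ltW.
rewrite -/m1 -/m2 in m1le m1gt m2le m2gt.
have {}m1le : m1%:R * t <= 2 * kappa by rewrite -ler_pdivlMr.
have {}m1gt : 2 * kappa < (m1%:R + 1) * t by rewrite -ltr_pdivrMr// natr1.
have e2 : (2 * t)^-1 * t = 1 / 2 by field; rewrite gt_eqF.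
have {}m2le : m2%:R * t <= 1 / 2 by rewrite -e2 ler_pM2r.
have {e2}m2gt : 1 / 2 < (m2%:R + 1) * t by rewrite -e2 ltr_pM2r// natr1.
have m2_gt0 : (0 < m2)%N.
  by rewrite lt0n; apply: contraTneq m2gt => ->; rewrite -leNgt; lra.
(* Such a difference is q m with m1 < m < m2. Then m q theta is at distance m t from the integer m
   a, which is more than 2 kappa and at most 1/2, so no integer is within 2 kappa of it. *)
have far (u v : 'I_N) : u \in H -> v \in H -> (u < v)%N ->
    (v - u < q * m2)%N -> (u = v %[mod q * m1.+1])%N -> False.
  move=> uH vH uv vu /eqP; rewrite eq_sym eqn_mod_dvd 1?ltnW// => /dvdnP[k hk].
  have k0 : (0 < k)%N.
    by rewrite lt0n; apply: contraTneq uv => k0; rewrite -leqNgt -subn_eq0 hk k0.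
  have [b] := near_sub _ _ uH vH uv.
  rewrite hk in vu *; pose m := (k * m1.+1)%N.
  have -> : (k * (q * m1.+1) = m * q)%N by rewrite mulnA mulnAC.
  have mm2 : (m < m2)%N by move: vu; rewrite mulnCA ltn_pmul2l.
  have mm1 : (m1 < m)%N by rewrite leq_pmull.
  have mt2 : m%:R * t <= 1 / 2.
    by apply: le_trans m2le; rewrite ler_pM2r// ler_nat ltnW.
  have mt1 : 2 * kappa < m%:R * t.
    by apply: lt_le_trans m1gt _; rewrite ler_pM2r// natr1 ler_nat.
  have em : m%:R * t = `|(m * q)%:R * theta - (m%:Z * a)%:~R|.
    by rewrite natrM intrM -mulrA -mulrBr normrM normr_nat.
  rewrite em in mt1 mt2; move: mt1 mt2; set ma := (_ * a).
  have [->|bm] := eqVneq b ma; first by move=> h1 _ h2; lra.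
  have : 1 <= `|b%:~R - ma%:~R| :> R.
    by rewrite -intrB -intr_norm ler1z -gtz0_ge1 normr_gt0 subr_eq0.
  rewrite !ler_norml ler_normr => /orP[] h1 _ /andP[h2 h3] /andP[h4 h5]; lra.
(* By [far], an element of [H] is determined by its block of length q m2 and its residue modulo q
   (m1 + 1). *)
have : (#|H| <= q * m1.+1 * (N %/ (q * m2)).+1)%N.
  set K := (q * m1.+1)%N; set L := (q * m2)%N.
  have K0 : (0 < K)%N by rewrite muln_gt0 q0.
  have L0 : (0 < L)%N by rewrite muln_gt0 q0.
  apply: (@card_le_inj _ H (fun h : 'I_N => (h %/ L) * K + h %% K)%N) => [h _|u v uH vH e].
    have h1 : (h %% K < K)%N by rewrite ltn_mod.
    have h2 : (h %/ L <= N %/ L)%N by rewrite leq_div2r// ltnW.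
    by rewrite mulnS mulnC -addnS addnC leq_add// leq_mul2l h2 orbT.
  have eL : (u %/ L = v %/ L)%N.
    by have := congr1 (divn^~ K) e; rewrite !divnMDl// !(divn_small (ltn_pmod _ K0)) !addn0.
  have eK : (u = v %[mod K])%N.
    by have := congr1 (modn^~ K) e; rewrite !modnMDl !modn_mod.
  have hu := divn_eq u L; have hv := divn_eq v L.
  have mu : (u %% L < L)%N by rewrite ltn_mod.
  have mv : (v %% L < L)%N by rewrite ltn_mod.
  rewrite eL in hu; apply/val_inj/eqP => /=; case: ltngtP => // h.
    case: (far u v) => //; rewrite -(ltn_add2r u) subnK ?(ltnW h)// [(_ + u)%N]addnC.
    by rewrite hv hu -addnA ltn_add2l (leq_trans mv)// leq_addl.
  case: (far v u) => //; rewrite -(ltn_add2r v) subnK ?(ltnW h)// [(_ + v)%N]addnC.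
  by rewrite hv hu -addnA ltn_add2l (leq_trans mu)// leq_addl.
move=> hcard.
have NR : N%:R <= E%:R * ((q * m1.+1)%:R * (N%:R / (q * m2)%:R + 1)) :> R.
  apply: (@le_trans _ _ (E * (q * m1.+1 * (N %/ (q * m2)).+1))%:R).
    by rewrite ler_nat (leq_trans NH)// leq_mul2l hcard orbT.
  rewrite [in X in X <= _]natrM [in X in X <= _]natrM ler_wpM2l// ler_wpM2l//.
  rewrite -natr1 lerD2r ler_pdivlMr ?ltr0n ?muln_gt0 ?q0//.
  by rewrite -natrM ler_nat leq_trunc_div.
have q1 : 1 <= q%:R :> R by rewrite ler1n.
have m21 : 1 <= m2%:R :> R by rewrite ler1n.
have qE : q%:R <= 2 * E%:R :> R by rewrite -natrM ler_nat ltnW.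
have N0 : 0 < N%:R :> R by rewrite ltr0n (leq_ltn_trans _ EN).
have K4 : m1.+1%:R * t <= 4 * kappa.
  by rewrite -natr1 mulrDl mul1r; lra.
have KL : m1.+1%:R <= 16 * kappa * m2%:R.
  rewrite -(ler_pM2r t0); apply: le_trans K4 _.
  have : 1 / 4 <= m2%:R * t by nra.
  nra.
(* By [KL] and 32 E kappa <= 1, the term with N / (q m2) is at most N / 2; the summand 1 has to
   carry the other half. *)
have EK : N%:R <= 2 * E%:R * q%:R * m1.+1%:R :> R.
  have : E%:R * ((q * m1.+1)%:R * (N%:R / (q * m2)%:R)) <= N%:R / 2 :> R.
    have -> : E%:R * ((q * m1.+1)%:R * (N%:R / (q * m2)%:R)) =
              E%:R * N%:R * (m1.+1%:R / m2%:R) :> R.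
      rewrite !natrM; field.
      by apply/andP; split; rewrite gt_eqF// (lt_le_trans ltr01).
    apply: (@le_trans _ _ (E%:R * N%:R * (16 * kappa))).
      by rewrite ler_wpM2l ?mulr_ge0// ler_pdivrMr// (lt_le_trans ltr01).
    nra.
  move: NR; rewrite mulrDr mulrDr mulr1 [(q * m1.+1)%:R]natrM; nra.
rewrite ler_pdivlMr// mulrC.
apply: (@le_trans _ _ (2 * E%:R * q%:R * (m1.+1%:R * t))).
  by rewrite mulrA ler_pM2r.
apply: (@le_trans _ _ (2 * E%:R * q%:R * (4 * kappa))).
  by rewrite ler_wpM2l// !mulr_ge0.
have : q%:R * (E%:R * kappa) <= (2 * E%:R) * (E%:R * kappa).
  by rewrite ler_wpM2r// mulr_ge0.
by rewrite expr2; lra.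
Qed.

End NearInteger.

(** * Weyl's inequality for the leading coefficient *)

Lemma card_cover_le (T : finType) (H : {set T}) K (F : 'I_K -> {set T}) :
  (0 < #|H|)%N -> H \subset (\bigcup_i F i)%SET ->
  exists i, (#|H| <= K * #|F i|)%N.
Proof.
move=> H0 HF; apply: contrapT => no.
have {}no i : (K * #|F i| < #|H|)%N.
  by rewrite ltnNge; apply/negP => h; apply: no; exists i.
have h1 : (#|H| <= \sum_i #|F i|)%N.
  by rewrite (leq_trans (subset_leq_card HF))// unstable.card_big_setU.
have h2 : (K * \sum_i #|F i| <= \sum_(i < K) (#|H|).-1)%N.
  by rewrite big_distrr/= leq_sum// => i _; rewrite -ltnS (prednK H0).
have K0 : (0 < K)%N.
  by case: K F HF {no h1 h2} => // F; rewrite big_ord0 finset.subset0 -cards_eq0 eqn0Ngt H0.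
rewrite sum_nat_const card_ord leq_pmul2l// in h2.
by have := leq_trans h1 h2; rewrite -ltnS (prednK H0) ltnn.
Qed.

Section Weyl.
Variable R : realType.
Implicit Types (P : {poly R}) (x : R) (D N : nat).

Definition weyl_sum P N : R[i] := \sum_(n < N) expi2pi P.[n%:R].

(** The tolerance is at least 1 here, so every real qualifies. This disposes of small [N] below. *)
Lemma near_int_trivial x D N b j c : (0 < D)%N -> (0 < N)%N -> (N <= D ^ b)%N ->
  (b * j <= c)%N -> near_int x (D%:R ^+ c / N%:R ^+ j).
Proof.
move=> D0 N0 ND bj; apply: near_int_le (near_int_half x).
apply: (@le_trans _ _ 1); first by lra.
rewrite ler_pdivlMr ?exprn_gt0 ?ltr0n// mul1r -!natrX ler_nat.
apply: (@leq_trans ((D ^ b) ^ j)); first by case: (j) => // i; rewrite leq_exp2r.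
by rewrite -expnM leq_pexp2l.
Qed.

(** In van der Corput's inequality the diagonal contributes at most N^2 / (4 D^2), since 4 D^2 <= N,
    and so do the shifts outside the set, counted twice. The shifts in the set account for the
    remaining half of N^2 / D^2. *)
Lemma many_large_differences (f : nat -> R) D N : (0 < D)%N ->
  (4 * D ^ 2 <= N)%N ->
  N%:R <= D%:R * cabs (\sum_(n < N) expi2pi (f n)) ->
  (N <= 4 * D ^ 2 * #|[set h : 'I_N | (N%:R <= (8 * D ^ 2)%:R *
    cabs (\sum_(n < N - h.+1) expi2pi (f (n + h.+1)%N - f n)))%R]%SET|)%N.
Proof.
move=> D0 DN big; set H := [set h | _]%SET.
set S := fun h : 'I_N => cabs (\sum_(n < N - h.+1) expi2pi (f (n + h.+1)%N - f n)).
have N0 : 0 < N%:R :> R by rewrite ltr0n (leq_trans _ DN)// muln_gt0 expn_gt0 D0.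
set x : R := N%:R in big N0 *; set y : R := D%:R in big *.
have y0 : 0 < y by rewrite ltr0n.
have y2 : (D ^ 2)%:R = y ^+ 2 :> R by rewrite natrX.
have xy : 4 * y ^+ 2 <= x by rewrite -y2 -natrM ler_nat.
have hS : \sum_(h < N) S h <= #|H|%:R * x + x * (x / (8 * y ^+ 2)).
  rewrite (bigID (mem H))/=; apply: lerD.
    rewrite -sumr_const mulr_suml; apply: ler_sum => h _; rewrite mul1r.
    apply: le_trans (cabs_sum_expi2pi_le (fun n => f (n + h.+1)%N - f n) _) _.
    by rewrite ler_nat leq_subr.
  apply: (@le_trans _ _ (\sum_(h : 'I_N) x / (8 * y ^+ 2))); last first.
    by rewrite sumr_const card_ord -[leLHS]mulr_natl.
  rewrite big_mkcond/=; apply: ler_sum => h _; case: ifPn => [|_].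
    rewrite inE -ltNge natrM y2 => hh.
    by rewrite ler_pdivlMr ?mulr_gt0 ?exprn_gt0// mulrC ltW.
  by rewrite divr_ge0 ?mulr_ge0 ?ltW ?exprn_gt0.
have vdc := van_der_corput f N.
set c := cabs _ in big vdc; have c0 : 0 <= c by exact: cabs_ge0.
have xc : x ^+ 2 <= y ^+ 2 * c ^+ 2 by rewrite -exprMn ler_sqr ?nnegrE ?mulr_ge0// ltW.
rewrite -/x in vdc.
have {hS}vdc : x ^+ 2 <= y ^+ 2 * (x + 2 * (#|H|%:R * x + x * (x / (8 * y ^+ 2)))).
  apply: le_trans xc _; rewrite ler_wpM2l ?sqr_ge0//; apply: le_trans vdc _.
  by rewrite lerD2l ler_pM2l.
have e : y ^+ 2 * (x + 2 * (#|H|%:R * x + x * (x / (8 * y ^+ 2)))) =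
  x * (y ^+ 2 + 2 * y ^+ 2 * #|H|%:R + x / 4) by field; rewrite gt_eqF.
move: vdc; rewrite e expr2 ler_pM2l// => vdc.
by rewrite -(ler_nat R) natrM [(4 * _)%:R]natrM y2 -/x; lra.
Qed.

(** In the induction step many shifts h leave a large sum for the difference polynomial, whose
    leading coefficient is (d + 2) h P_(d+2). The denominators found for it depend on h;
    pigeonholing keeps a single q for a proportion B^(-c) of these shifts, and Vinogradov's lemma
    applies to theta = q (d + 2) P_(d+2). *)
Lemma weyl_leading d : exists c, forall D N P,
  (1 < D)%N -> (0 < N)%N -> (size P <= d.+2)%N ->
  N%:R <= D%:R * cabs (weyl_sum P N) ->
  exists2 q, (0 < q <= D ^ c)%N &
    near_int (q%:R * P`_d.+1) (D%:R ^+ c / N%:R ^+ d.+1).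
Proof.
elim: d => [|d [c IH]].
  (* In degree one the sum is geometric and q = 1 suffices. *)
  exists 1%N => D N P D1 N0 sP big; exists 1%N; first by rewrite /= expn1 ltnW.
  rewrite mul1r !expr1; exists (nint P`_1).
  have := cabs_geometric_le P`_1 P`_0 N.
  have -> : \sum_(n < N) expi2pi (P`_1 * n%:R + P`_0) = weyl_sum P N.
    apply: eq_bigr => n _; congr expi2pi.
    rewrite (@horner_coef_wide _ 2)// !big_ord_recr big_ord0/= add0r expr0 expr1 mulr1.
    by rewrite addrC.
  move=> h; rewrite ler_pdivlMr ?ltr0n//.
  apply: (@le_trans _ _ (D%:R * (`|P`_1 - (nint P`_1)%:~R| * cabs (weyl_sum P N)))).
    by rewrite mulrCA ler_wpM2l.
  by rewrite -[leRHS]mulr1 ler_wpM2l.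
(* With B = D^5, N > D^b means N > B^(2c+d+4), enough for the conditions 2 E < N and 32 E kappa <= 1
   of [vinogradov]. The summands of [c'] cover small N, the size of the final denominator and its
   tolerance. *)
pose b := (5 * (2 * c + d + 4))%N.
pose c' := (b * d.+2 + 5 * (2 * c + 1) + 5 * (3 * c + d + 3) + d + 7)%N.
exists c' => D N P D1 N0 sP big.
have D0 : (0 < D)%N by exact: ltnW.
have [ND|ND] := leqP N (D ^ b).
  exists 1%N; first by rewrite expn_gt0 D0.
  by apply: near_int_trivial ND _ => //; rewrite /c'; lia.
(* As D >= 2, the fifth power absorbs the constants: 8 D^2 <= B and 32 <= B. *)
pose B := (D ^ 5)%N.
have pow2 n : (2 ^ n <= D ^ n)%N by case: n => // n; rewrite leq_exp2r.
have B32 : (32 <= B)%N by exact: (pow2 5%N).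
have B8 : (8 * D ^ 2 <= B)%N.
  by rewrite /B (expnD D 3 2) leq_mul2r (pow2 3%N) orbT.
have BN : (B ^ (2 * c + d + 4) < N)%N by rewrite /B -expnM.
have BN1 : (B <= N)%N.
  by rewrite ltnW// (leq_ltn_trans _ BN)// -[X in (X <= _)%N]expn1 leq_pexp2l; lia.
pose H := [set h : 'I_N | (N%:R <= B%:R *
  cabs (weyl_sum (poly_diff P h.+1%:R) (N - h.+1)))%R]%SET.
have HN : (N <= B * #|H|)%N.
  have := @many_large_differences (fun n => P.[n%:R]) D N D0 _ big.
  have h4 : (4 * D ^ 2 <= B)%N by rewrite (leq_trans _ B8)// leq_mul2r orbT.
  move=> /(_ (leq_trans h4 BN1)) /leq_trans; apply; apply: leq_mul => //.
  apply: subset_leq_card; apply/fintype.subsetP => h; rewrite !inE => /le_trans; apply.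
  rewrite ler_pM ?cabs_ge0// ?ler_nat//.
  rewrite le_eqVlt; apply/orP; left; apply/eqP; congr cabs.
  by apply: eq_bigr => n _; rewrite horner_poly_diff natrD.
(* The induction hypothesis gives the tolerance B^c / L^(d+1) with L = N - h - 1. A sum of L terms
   of size at least N / B forces N <= B L. *)
pose kap : R := B%:R ^+ (c + d.+1) / N%:R ^+ d.+1.
pose F (i : 'I_(B ^ c)) := [set h : 'I_N |
  `[< near_int (h.+1%:R * (i.+1%:R * (d.+2%:R * P`_d.+2))) kap >]]%SET.
have NR0 : 0 < N%:R :> R by rewrite ltr0n.
have [||i hi] := @card_cover_le _ H _ F.
- by rewrite lt0n; apply: contraTneq HN => ->; rewrite muln0 -ltnNge.
- apply/fintype.subsetP => h; rewrite inE => hbig.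
  have NL : (N <= B * (N - h.+1))%N.
    rewrite -(ler_nat R) (le_trans hbig)// natrM ler_wpM2l//.
    exact: (cabs_sum_expi2pi_le (fun n => (poly_diff P h.+1%:R).[n%:R])).
  have L0 : (0 < N - h.+1)%N.
    by rewrite lt0n; apply: contraTneq NL => ->; rewrite muln0 -ltnNge.
  have [||q /andP[q0 qB] hq] := IH B (N - h.+1)%N _ _ L0 (size_poly_diff h.+1%:R sP).
  + by rewrite (leq_trans _ B32).
  + by apply: le_trans hbig; rewrite ler_nat leq_subr.
  have qlt : (q.-1 < B ^ c)%N by rewrite prednK.
  apply/bigcupP; exists (Ordinal qlt) => //; rewrite inE; apply/asboolP => /=.
  rewrite prednK//; rewrite coef_poly_diff// in hq.
  have -> : h.+1%:R * (q%:R * (d.+2%:R * P`_d.+2)) =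
     q%:R * (d.+2%:R * h.+1%:R * P`_d.+2) by ring.
  apply: near_int_le hq; rewrite ler_pdivrMr ?exprn_gt0 ?ltr0n//.
  rewrite /kap exprD -!mulrA -[leLHS]mulr1 ler_wpM2l ?exprn_ge0// -exprVn -!exprMn.
  apply: exprn_ege1; rewrite mulrCA mulrC -natrM.
  by rewrite ler_pdivlMr// mul1r ler_nat.
(* The density loss is B for the large differences times B^c for the common denominator. *)
set H' := F i in hi; pose E := (B ^ c.+1)%N.
have E0 : (0 < E)%N by rewrite expn_gt0 expn_gt0 D0.
have NE : (N <= E * #|H'|)%N.
  by rewrite (leq_trans HN)// /E expnS -mulnA leq_mul2l hi orbT.
have EN : (2 * E < N)%N.
  apply: leq_ltn_trans BN; apply: (@leq_trans (B ^ c.+2)).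
    by rewrite [(B ^ c.+2)%N]expnS leq_mul2r (leq_trans _ B32) ?orbT.
  by rewrite leq_pexp2l// ?expn_gt0 ?D0//; lia.
have Ekap : 32 * E%:R * kap <= 1.
  rewrite /kap mulrA ler_pdivrMr ?exprn_gt0// mul1r -!natrX -!natrM ler_nat.
  apply: (@leq_trans ((B ^ (2 * c + d + 4)) ^ d.+1)%N); last first.
    by rewrite leq_exp2r// ltnW.
  rewrite -expnM; apply: (@leq_trans (B * B ^ c.+1 * B ^ (c + d.+1))%N).
    by rewrite !leq_mul2r B32 !orbT.
  rewrite -expnS -expnD leq_pexp2l ?expn_gt0 ?D0//; nia.
have [h|q' /andP[q'0 q'E] hq'] := @vinogradov R
  (i.+1%:R * (d.+2%:R * P`_d.+2)) kap N E H' E0 EN NE Ekap.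
  by rewrite inE => /asboolP; exact.
(* Vinogradov's denominator, times the common one, times the factor d + 2 from differencing. *)
exists (q' * i.+1 * d.+2)%N.
  rewrite !muln_gt0 q'0/=.
  apply: (@leq_trans (D ^ 1 * B ^ c.+1 * B ^ c * D ^ d.+2)%N).
    apply: leq_mul; last by rewrite (leq_trans _ (pow2 _))// ltnW// ltn_expl.
    apply: leq_mul; last exact: ltn_ord.
    by rewrite (leq_trans q'E)// leq_mul2r expn1 D1 orbT.
  by rewrite /B -!expnM -!expnD leq_pexp2l// /c'; nia.
have -> : (q' * i.+1 * d.+2)%:R * P`_d.+2 = q'%:R * (i.+1%:R * (d.+2%:R * P`_d.+2)) :> R.
  by rewrite !natrM !mulrA.
apply: near_int_le hq'.
have -> : 16 * E%:R ^+ 2 * kap / N%:R =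
    16 * E%:R ^+ 2 * B%:R ^+ (c + d.+1) / N%:R ^+ d.+2 :> R.
  by rewrite /kap [N%:R ^+ d.+2]exprSr invfM !mulrA.
rewrite ler_wpM2r ?invr_ge0 ?exprn_ge0//.
rewrite -!natrX -!natrM ler_nat.
apply: (@leq_trans (D ^ 4 * (B ^ c.+1) ^ 2 * B ^ (c + d.+1))%N).
  by rewrite !leq_mul2r (pow2 4%N) !orbT.
by rewrite /B -!expnM -!expnD leq_pexp2l// /c'; nia.
Qed.

End Weyl.

(** * Weyl's inequality for the lower coefficients *)

Section Coefficients.
Variable R : realType.
Implicit Types (P : {poly R}) (x y : R) (D N : nat).

Lemma near_intD x y k l : near_int x k -> near_int y l -> near_int (x + y) (k + l).
Proof.
move=> [m hm] [n hn]; exists (m + n); rewrite intrD opprD addrACA.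
by rewrite (le_trans (ler_normD _ _))// lerD.
Qed.

Lemma near_int0 k : 0 <= k -> near_int (0 : R) k.
Proof. by move=> k0; exists 0; rewrite mulr0z subrr normr0. Qed.

Lemma near_int_sum n (F G : 'I_n -> R) : (forall i, near_int (F i) (G i)) ->
  near_int (\sum_i F i) (\sum_i G i).
Proof.
move=> h; elim/big_ind2: _ => //; first exact: near_int0.
by move=> *; exact: near_intD.
Qed.

Lemma cabs_expi2pi_near x y k : near_int (x - y) k ->
  cabs (expi2pi x - expi2pi y) <= 8 * k.
Proof.
move=> [m hm]; rewrite -(expi2piDint y m).
by rewrite (le_trans (cabs_expi2pi_sub _ _))// opprD addrA ler_pM2l.
Qed.

(** (u + q m)^i - u^i is q m times a sum of i natural numbers, each at most (2 N)^(i-1), so its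
    product with alpha is a controlled multiple of q alpha. *)
Lemma near_int_powB (alpha k : R) (q u m i N : nat) :
  near_int (q%:R * alpha) k -> (u < N)%N -> (q * m <= N)%N ->
  near_int (alpha * ((u + q * m)%:R ^+ i - u%:R ^+ i))
    (m%:R * i%:R * (2 * N%:R) ^+ i.-1 * k).
Proof.
move=> [a ha] uN qN; rewrite subrXX.
pose w := (m * \sum_(l < i) (u + q * m) ^ (i.-1 - l) * u ^ l)%N.
have we : \sum_(l < i) (u + q * m)%:R ^+ (i.-1 - l) * u%:R ^+ l =
  (\sum_(l < i) (u + q * m) ^ (i.-1 - l) * u ^ l)%:R :> R.
  by rewrite natr_sum; apply: eq_bigr => l _; rewrite natrM !natrX.
have -> : alpha * (((u + q * m)%:R - u%:R) *
    (\sum_(l < i) (u + q * m)%:R ^+ (i.-1 - l) * u%:R ^+ l)) = w%:R * (q%:R * alpha).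
  rewrite we natrD addrAC subrr add0r !natrM; ring.
apply: near_int_le (near_int_mul w (ex_intro _ a ha)).
have k0 : 0 <= k by exact: le_trans ha.
rewrite ler_wpM2r// /w natrM -mulrA ler_wpM2l// -natrM -natrX -natrM ler_nat.
apply: (@leq_trans (\sum_(l < i) (2 * N) ^ i.-1)%N).
  apply: leq_sum => l _.
  apply: (@leq_trans ((2 * N) ^ (i.-1 - l) * (2 * N) ^ l)%N).
    have le_exp a' b' e : (a' <= b' -> a' ^ e <= b' ^ e)%N.
      by case: e => // e; rewrite leq_exp2r.
    by apply: leq_mul; apply: le_exp; lia.
  by rewrite -expnD subnK//; have := ltn_ord l; lia.
by rewrite sum_nat_const card_ord.
Qed.

Lemma cabs_sum_shift (F : nat -> R[i]) N k : (forall n, cabs (F n) <= 1) ->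
  cabs (\sum_(n < N) F n - \sum_(n < N) F (n + k)%N) <= 2 * k%:R.
Proof.
move=> F1; elim: k => [|k IH].
  under [X in _ - X]eq_bigr => i _ do rewrite addn0.
  by rewrite subrr cabs0 mulr0.
have e : \sum_(n < N) F (n + k)%N - \sum_(n < N) F (n + k.+1)%N = F k - F (N + k)%N.
  have : \sum_(n < N.+1) F (n + k)%N = F k + \sum_(n < N) F (n + k.+1)%N.
    by rewrite big_ord_recl add0n; congr (_ + _); apply: eq_bigr => i _; rewrite addSnnS.
  rewrite big_ord_recr/= => /(canRL (addrK _)) ->; ring.
rewrite -[X in X - _](subrK (\sum_(n < N) F (n + k)%N)) -addrA e.
rewrite (le_trans (cabsD _ _))// -[k.+1%:R]natr1 mulrDr lerD// mulr1.
by rewrite (le_trans (cabsB _ _))//; have := F1 k; have := F1 (N + k)%N; lra.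
Qed.

(** Translating the sum by q m costs at most 2 q m. Averaging over m < M therefore turns it into a
    mean over u < N of sums along u + q m, and some u does at least as well as the mean. *)
Lemma large_progression (F : nat -> R[i]) D N M q : (forall n, cabs (F n) <= 1) ->
  (0 < D)%N -> (0 < N)%N -> N%:R <= D%:R * cabs (\sum_(n < N) F n) ->
  exists2 u, (u < N)%N & M%:R / D%:R - 2 * q%:R * M%:R ^+ 2 / N%:R <=
    cabs (\sum_(m < M) F (u + q * m)%N).
Proof.
move=> F1 D0 N0 big; apply: contrapT => no.
have D0' : 0 < D%:R :> R by rewrite ltr0n.
have N0' : 0 < N%:R :> R by rewrite ltr0n.
set X := M%:R / D%:R - _ in no.
have {no}no (u : 'I_N) : cabs (\sum_(m < M) F (u + q * m)%N) < X.
  by rewrite ltNge; apply/negP => h; apply: no; exists u.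
have h1 : cabs (\sum_(m < M) (\sum_(n < N) F n - \sum_(n < N) F (n + q * m)%N)) <=
    2 * q%:R * M%:R ^+ 2.
  rewrite (le_trans (cabs_sum _ _ _))//.
  apply: (@le_trans _ _ (\sum_(m < M) 2 * q%:R * M%:R)).
    apply: ler_sum => m _; rewrite (le_trans (cabs_sum_shift _ _ F1))//.
    by rewrite natrM mulrA ler_wpM2l// ?mulr_ge0// ler_nat ltnW.
  by rewrite sumr_const card_ord -[leLHS]mulr_natr expr2 !mulrA.
have h2 : cabs (\sum_(m < M) \sum_(n < N) F (n + q * m)%N) < N%:R * X.
  rewrite exchange_big/= (le_lt_trans (cabs_sum _ _ _))//.
  have -> : N%:R * X = \sum_(n < N) X by rewrite sumr_const card_ord mulr_natl.
  by apply: ltr_sum => //; apply/hasP; exists (Ordinal N0); rewrite ?mem_index_enum.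
have h3 : M%:R * cabs (\sum_(n < N) F n) <= 2 * q%:R * M%:R ^+ 2 +
    cabs (\sum_(m < M) \sum_(n < N) F (n + q * m)%N).
  have -> : M%:R * cabs (\sum_(n < N) F n) = cabs (\sum_(m < M) \sum_(n < N) F n).
    rewrite [in RHS]sumr_const card_ord -[in RHS]mulr_natl cabsM; congr (_ * _).
    by rewrite /cabs normr_nat -(rmorph_nat (real_complex R)).
  rewrite -[X in cabs X <= _](subrK (\sum_(m < M) \sum_(n < N) F (n + q * m)%N)).
  by rewrite (le_trans (cabsD _ _))// lerD2r -sumrB.
have h4 : M%:R * (N%:R / D%:R) <= M%:R * cabs (\sum_(n < N) F n).
  by rewrite ler_wpM2l// ler_pdivrMr// mulrC.
have : N%:R * X = M%:R * (N%:R / D%:R) - 2 * q%:R * M%:R ^+ 2.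
  by rewrite /X; field; rewrite !gt_eqF.
lra.
Qed.

(* Along the progression u + q m the coefficients above j + 1 contribute an
   almost constant phase, so that only the part of degree j + 1 remains. *)
Lemma weyl_lower_coefficient d j c : (j < d)%N ->
  (forall D N P, (1 < D)%N -> (0 < N)%N -> (size P <= d.+2)%N ->
    N%:R <= D%:R * cabs (weyl_sum P N) ->
    exists2 q, (0 < q <= D ^ c)%N & forall i, (j.+1 < i <= d.+1)%N ->
      near_int (q%:R * P`_i) (D%:R ^+ c / N%:R ^+ i)) ->
  exists c', forall D N P, (1 < D)%N -> (0 < N)%N -> (size P <= d.+2)%N ->
    N%:R <= D%:R * cabs (weyl_sum P N) ->
    exists2 q, (0 < q <= D ^ c')%N & forall i, (j < i <= d.+1)%N ->
      near_int (q%:R * P`_i) (D%:R ^+ c' / N%:R ^+ i).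
Proof.
move=> jd IH; have [cA hA] := weyl_leading R j.
(* The progression has length M, about N / D^g. The phase is constant along it up to M D^(c+3d+3) /
   N, and six more powers of D bring all errors below half of the main term M / D. *)
pose g := (c + 3 * d + 9)%N.
pose c' := (g * d.+1 + 2 * cA + g.+1 * j.+1 + c * j.+1)%N.
exists c' => D N P D1 N0 sP big.
have D0 : (0 < D)%N by exact: ltnW.
have [ND|ND] := leqP N (D ^ g).
  exists 1%N; first by rewrite expn_gt0 D0.
  move=> i /andP[_ id]; apply: near_int_trivial ND _ => //.
  by apply: (@leq_trans (g * d.+1)); rewrite ?leq_mul2l ?id ?orbT// /c' -!addnA leq_addr.
have [q /andP[q0 qD] hq] := IH D N P D1 N0 sP big.
pose M := (N %/ D ^ g)%N.
have Dg0 : (0 < D ^ g)%N by rewrite expn_gt0 D0.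
have M0 : (0 < M)%N by rewrite divn_gt0// ltnW.
have MN : (M * D ^ g <= N)%N by rewrite leq_trunc_div.
have NM : (N <= D ^ g.+1 * M)%N.
  rewrite expnS mulnAC -[M in (D * M)%N](prednK M0) (leq_trans (ltnW (ltn_ceil N Dg0)))//.
  by rewrite leq_mul2r -/M (prednK M0); apply/orP; right; nia.
have qMN : (q * M <= N)%N.
  apply: leq_trans MN; rewrite mulnC leq_mul2l (leq_trans qD) ?orbT//.
  by rewrite leq_pexp2l// /g; lia.
have [u uN hu] := @large_progression (fun n => expi2pi P.[n%:R]) D N M q
  (fun n => eq_ind_r (fun x => x <= 1) (lexx _) (cabs_expi2pi _)) D0 N0 big.
(* [Q] keeps the degrees up to j + 1; the coefficients of [T] are those already approximated by
   [hq]. *)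
pose Q : {poly R} := \poly_(i < j.+2) P`_i.
pose T := P - Q.
have sT : (size T <= d.+2)%N.
  rewrite (leq_trans (size_polyD _ _))// size_polyN geq_max sP.
  by rewrite (leq_trans (size_poly _ _))// ltnW.
have NR0 : 0 < N%:R :> R by rewrite ltr0n.
have DR1 : 1 <= D%:R :> R by rewrite ler1n.
pose err : R := M%:R * D%:R ^+ (c + 3 * d + 3) / N%:R.
have le_exp a' b' e : (a' <= b' -> a' ^ e <= b' ^ e)%N.
  by case: e => // e; rewrite leq_exp2r.
have hT (m : nat) : (m < M)%N -> near_int (T.[(u + q * m)%:R] - T.[u%:R]) err.
  move=> mM; rewrite !(horner_coef_wide _ sT) -sumrB.
  have qm : (q * m <= N)%N.
    by rewrite (leq_trans _ qMN)// leq_mul2l (ltnW mM) orbT.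
  apply: (@near_int_le _ _ (\sum_(i < d.+2)
      M%:R * D%:R ^+ (c + 2 * d + 1) / N%:R)).
    rewrite sumr_const card_ord -[leLHS]mulr_natr mulrAC /err.
    rewrite ler_wpM2r ?invr_ge0// -mulrA ler_wpM2l//.
    have -> : (c + 3 * d + 3 = (c + 2 * d + 1) + d.+2)%N by lia.
    rewrite [leRHS]exprD ler_wpM2l ?exprn_ge0//.
    by rewrite -natrX ler_nat (leq_trans (ltnW (ltn_expl d.+2 (ltnSn 1))))// le_exp.
  apply: near_int_sum => i; rewrite -mulrBr coefB coef_poly.
  case: ifPn => ij.
    rewrite subrr mul0r; apply: near_int0.
    by rewrite divr_ge0// mulr_ge0// exprn_ge0.
  rewrite subr0; have hi : (j.+1 < i <= d.+1)%N.
    by rewrite ltnNge ij/= -ltnS.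
  apply: near_int_le (near_int_powB i (hq _ hi) uN qm).
  rewrite -!mulrA [leLHS]mulrA [in leLHS]exprMn.
  have [i' ei] : exists i', i = i'.+1 :> nat.
    by case: (nat_of_ord i) hi => // i' _; exists i'.
  have i'd : (i' <= d)%N by move: hi; rewrite ei => /andP[].
  rewrite ei/=.
  have -> : m%:R * i'.+1%:R * (2 ^+ i' * N%:R ^+ i' * (D%:R ^+ c / N%:R ^+ i'.+1)) =
    m%:R * (i'.+1 * 2 ^ i')%:R * D%:R ^+ c / N%:R :> R.
    rewrite natrM natrX exprSr invfM; field.
    by rewrite expf_neq0 gt_eqF.
  rewrite !mulrA ler_wpM2r ?invr_ge0// -mulrA; apply: ler_pM => //.
  - by rewrite ler_nat ltnW.
  - rewrite -!natrX -!natrM ler_nat.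
    apply: (@leq_trans (D ^ d.+1 * D ^ d * D ^ c)%N).
      rewrite leq_mul2r; apply/orP; right; apply: leq_mul.
        by rewrite (leq_trans (ltn_expl i' D1))// leq_pexp2l// ltnW.
      by rewrite (leq_trans (le_exp _ _ _ D1))// leq_pexp2l.
    by rewrite -!expnD leq_pexp2l//; lia.
have hQ : weyl_sum (Q \Po (q%:R *: 'X + u%:R%:P)) M =
    \sum_(m < M) expi2pi Q.[(u + q * m)%:R].
  apply: eq_bigr => m _; rewrite horner_comp !hornerE; congr (expi2pi _.[_]).
  by rewrite natrD natrM addrC.
(* At least M / (2 D) survives, and 2 D <= D^2. *)
have big' : M%:R <= (D ^ 2)%:R * cabs (weyl_sum (Q \Po (q%:R *: 'X + u%:R%:P)) M).
  have h1 : cabs (\sum_(m < M) expi2pi P.[(u + q * m)%:R]) <=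
      cabs (weyl_sum (Q \Po (q%:R *: 'X + u%:R%:P)) M) + M%:R * (8 * err).
    have -> : \sum_(m < M) expi2pi P.[(u + q * m)%:R] =
      expi2pi T.[u%:R] * weyl_sum (Q \Po (q%:R *: 'X + u%:R%:P)) M +
      \sum_(m < M) expi2pi Q.[(u + q * m)%:R] *
        (expi2pi T.[(u + q * m)%:R] - expi2pi T.[u%:R]).
      rewrite hQ mulr_sumr -big_split/=; apply: eq_bigr => m _.
      have -> : P = Q + T by rewrite /T addrC subrK.
      by rewrite hornerD expi2piD; ring.
    rewrite (le_trans (cabsD _ _))// cabsM cabs_expi2pi mul1r lerD2l.
    rewrite (le_trans (cabs_sum _ _ _))// ?cabs_ge0//.
    have -> : M%:R * (8 * err) = \sum_(m < M) 8 * err.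
      by rewrite sumr_const card_ord mulr_natl.
    apply: ler_sum => m _.
    by rewrite cabsM cabs_expi2pi mul1r; apply: cabs_expi2pi_near; exact: hT.
  move: (le_trans hu h1); set W := cabs _ => h2.
  have h3 : 2 * q%:R * M%:R ^+ 2 / N%:R + M%:R * (8 * err) <= M%:R / (2 * D%:R).
    have -> : 2 * q%:R * M%:R ^+ 2 / N%:R + M%:R * (8 * err) =
       M%:R * ((M * (2 * q + 8 * D ^ (c + 3 * d + 3)))%:R / N%:R).
      by rewrite /err natrM natrD !natrM natrX; field; rewrite gt_eqF.
    rewrite ler_wpM2l// ler_pdivrMr// mulrC ler_pdivlMr ?mulr_gt0 ?ltr0n//.
    rewrite -!natrM ler_nat (leq_trans _ MN)// -mulnA leq_mul2l; apply/orP; right.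
    apply: (@leq_trans ((2 * D ^ (c + 3 * d + 3) + 8 * D ^ (c + 3 * d + 3)) * (2 * D))%N).
      rewrite leq_mul2r leq_add2r leq_mul2l (leq_trans qD) ?orbT//.
      by rewrite leq_pexp2l//; lia.
    have -> : (D ^ g)%N = (D ^ (c + 3 * d + 3) * D * D ^ 5)%N.
      by rewrite -expnSr -expnD; congr (_ ^ _)%N; rewrite /g; lia.
    have : (2 ^ 5 <= D ^ 5)%N by rewrite leq_exp2r.
    move: (D ^ (c + 3 * d + 3))%N (D ^ 5)%N => v w h.
    have -> : ((2 * v + 8 * v) * (2 * D) = v * D * 20)%N by ring.
    by rewrite leq_mul2l (leq_trans _ h) ?orbT.
  have h4 : M%:R / (2 * D%:R) <= W.
    have e : M%:R / D%:R = M%:R / (2 * D%:R) + M%:R / (2 * D%:R) :> R.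
      by field; rewrite gt_eqF// (lt_le_trans ltr01).
    lra.
  rewrite ler_pdivrMr ?mulr_gt0 ?ltr0n// in h4.
  apply: le_trans h4 _; rewrite mulrC ler_wpM2r ?cabs_ge0//.
  by rewrite natrX expr2 ler_wpM2r// ler_nat.
have sQ : (size (Q \Po (q%:R *: 'X + u%:R%:P))%R <= j.+2)%N.
  by rewrite (leq_trans (size_comp_affine _ _ _))// size_poly.
have D21 : (1 < D ^ 2)%N by rewrite (leq_trans D1)// -[X in (X <= _)%N]expn1 leq_pexp2l.
have [q1 /andP[q10 q1D]] := hA (D ^ 2)%N M _ D21 M0 sQ big'.
rewrite coef_comp_affine ?size_poly// coef_poly ltnSn => hq1.
rewrite -expnM in q1D.
(* The substitution q X + u multiplies the coefficient of degree j + 1 by q^(j+1). The product is a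
   multiple of q, so the higher coefficients stay near integers. *)
exists (q1 * q ^ j.+1)%N.
  rewrite muln_gt0 q10 expn_gt0 q0/=.
  apply: (@leq_trans (D ^ (2 * cA) * (D ^ c) ^ j.+1)%N).
    by rewrite leq_mul// leq_exp2r.
  by rewrite -expnM -expnD leq_pexp2l// /c'; lia.
move=> i /andP[]; rewrite leq_eqVlt => /predU1P[<- _|ji id].
  have -> : (q1 * q ^ j.+1)%:R * P`_j.+1 = q1%:R * (P`_j.+1 * q%:R ^+ j.+1).
    by rewrite natrM natrX; ring.
  apply: near_int_le hq1; rewrite ler_pdivrMr ?exprn_gt0 ?ltr0n//.
  rewrite -[_ / _ * _]mulrA -[X in _ * X]mulrC mulrA ler_pdivlMr ?exprn_gt0//.
  rewrite -!natrX -!natrM ler_nat -expnM.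
  apply: (@leq_trans (D ^ (2 * cA) * (D ^ g.+1 * M) ^ j.+1)%N).
    by rewrite leq_mul2l leq_exp2r// NM orbT.
  rewrite expnMn -expnM mulnA -expnD leq_mul2r leq_pexp2l ?orbT// /c'; lia.
have -> : (q1 * q ^ j.+1)%:R * P`_i = (q1 * q ^ j)%:R * (q%:R * P`_i) :> R.
  by rewrite expnSr mulnA natrM mulrA.
have ji' : (j.+1 < i <= d.+1)%N by rewrite ji.
apply: near_int_le (near_int_mul _ (hq _ ji')).
rewrite mulrA ler_wpM2r ?invr_ge0 ?exprn_ge0//.
rewrite -!natrX -!natrM ler_nat.
apply: (@leq_trans (D ^ (2 * cA) * (D ^ c) ^ j * D ^ c)%N).
  by rewrite leq_mul2r leq_mul ?orbT// le_exp.
by rewrite -expnM -!expnD leq_pexp2l// /c' [(c * j.+1)%N]mulnSr; lia.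
Qed.

(** Descending induction on [j], written as induction on r = d - j, starting from the leading
    coefficient. *)
Lemma weyl_coefficients d j : (j <= d)%N -> exists c, forall D N P,
  (1 < D)%N -> (0 < N)%N -> (size P <= d.+2)%N ->
  N%:R <= D%:R * cabs (weyl_sum P N) ->
  exists2 q, (0 < q <= D ^ c)%N & forall i, (j < i <= d.+1)%N ->
    near_int (q%:R * P`_i) (D%:R ^+ c / N%:R ^+ i).
Proof.
move=> jd; rewrite -(subKn jd); move: (d - j)%N (leq_subr j d) => r.
elim: r => [_|r IH rd].
  have [c hc] := weyl_leading R d; exists c => D N P D1 N0 sP big.
  have [q hq hq'] := hc D N P D1 N0 sP big; exists q => // i.
  by rewrite subn0 => hi; have -> : i = d.+1 by lia.
have [c hc] := IH (ltnW rd); apply: (@weyl_lower_coefficient d (d - r.+1) c).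
  by lia.
by have -> : ((d - r.+1).+1 = d - r)%N by lia.
Qed.

End Coefficients.

(** * Coefficients of finite Diophantine type *)

Section Diophantine.
Variable R : realType.
Implicit Types (P : {poly R}) (theta : R).

Lemma dist_int_le (x : R) (m : int) : dist_int x <= `|x - m%:~R|.
Proof.
apply: ge_inf; last by exists m.
by exists 0 => _ [n _ <-]; exact: normr_ge0.
Qed.

(** The positive lower limit bounds q^k ||q theta|| below only for q >= n. Passing from q to its
    multiple (n + 1) q reaches that range and costs a factor (n + 1)^(k+1). *)
Lemma finite_diophantine_typeP theta : finite_diophantine_type theta ->
  exists k (c : R), 0 < c /\ forall (q : nat) (m : int), (0 < q)%N ->
    c <= q%:R ^+ k * `|q%:R * theta - m%:~R|.
Proof.
move=> [k _]; rewrite limn_einf_lim.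
rewrite (cvg_lim (@ereal_hausdorff R) (@cvg_einfs_sup R _)) => /ereal_sup_gt.
move=> [_ [n _ <-]]; rewrite /einfs/=; set S := sdrop _ _ => S0.
have [c c0 hc] : exists2 c : R, 0 < c & forall q, (n <= q)%N ->
    c <= q%:R ^+ k * dist_int (q%:R * theta).
  have lb q : (n <= q)%N ->
      (ereal_inf S <= (q%:R ^+ k * dist_int (q%:R * theta))%:E)%E.
    by move=> nq; apply: ereal_inf_lbound; exists q.
  move: (ereal_inf S) S0 lb => [s| |]//.
    by rewrite lte_fin => s0 lb; exists s => // q /lb; rewrite lee_fin.
  by move=> _ /(_ n (leqnn _)); rewrite leye_eq.
exists k, (c / n.+1%:R ^+ k.+1); split.
  by rewrite divr_gt0// exprn_gt0// ltr0n.
move=> q m q0; rewrite ler_pdivrMr ?exprn_gt0 ?ltr0n//.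
have nq : (n <= n.+1 * q)%N by rewrite (leq_trans (leqnSn _))// leq_pmulr.
apply: le_trans (hc _ nq) _.
apply: (@le_trans _ _ ((n.+1 * q)%:R ^+ k * (n.+1%:R * `|q%:R * theta - m%:~R|))).
  rewrite ler_wpM2l ?exprn_ge0//.
  apply: le_trans (dist_int_le _ (n.+1%:Z * m)) _.
  rewrite natrM intrM -mulrA -mulrBr normrM normr_nat//.
by rewrite natrM exprMn exprS le_eqVlt; apply/orP; left; apply/eqP; ring.
Qed.

(** If the bound fails, some q <= D^c puts q h P_i within D^c / N of an integer, whatever [lam] is,
    because i >= 2. Finite type makes this distance at least c0 / (q h)^k, so that c0 N <= D^(c k +
    c) h^k, contrary to D^s <= N once D > h^k / c0. *)
Lemma weyl_sum_bound d P i h : (size P <= d.+2)%N -> (1 < i <= d.+1)%N ->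
  finite_diophantine_type P`_i -> (0 < h)%N ->
  exists s D0 : nat, forall (D N : nat) (lam : R), (D0 <= D)%N -> (D ^ s <= N)%N ->
    D%:R * cabs (weyl_sum (h%:R *: P + lam *: 'X) N) <= N%:R.
Proof.
move=> sP hi /finite_diophantine_typeP[k [c0 [c0_gt0 hc0]]] h0.
have d0 : (0 < d)%N by lia.
have [c hc] := weyl_coefficients R d0.
pose B := Num.truncn (h%:R ^+ k / c0).
exists (c * k + c + 1)%N, (maxn 2 B.+1) => D N lam; rewrite geq_max => /andP[D1 BD] DN.
have D0 : (0 < D)%N by exact: ltnW.
have N0 : (0 < N)%N by rewrite (leq_trans _ DN)// expn_gt0 D0.
rewrite leNgt; apply/negP => big.
have sQ : (size (h%:R *: P + lam *: 'X)%R <= d.+2)%N.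
  rewrite (leq_trans (size_polyD _ _))// geq_max.
  rewrite !(leq_trans (size_scale_leq _ _))//.
  by rewrite size_polyX.
have [q /andP[q0 qD] hq] := hc D N _ D1 N0 sQ (ltW big).
have [m] := hq i hi.
rewrite coefD !coefZ coefX gtn_eqF; last by case/andP: hi.
rewrite mulr0 addr0 mulrA -natrM => hm.
have qh0 : (0 < q * h)%N by rewrite muln_gt0 q0.
have h1 := hc0 (q * h)%N m qh0.
have NR0 : 0 < N%:R :> R by rewrite ltr0n.
have h2 : c0 <= (q * h)%:R ^+ k * (D%:R ^+ c / N%:R ^+ i).
  by apply: le_trans h1 _; rewrite ler_wpM2l// exprn_ge0.
rewrite mulrA ler_pdivlMr ?exprn_gt0// in h2.
have h3 : c0 * N%:R <= (D ^ (c * k + c))%:R * h%:R ^+ k.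
  apply: (@le_trans _ _ (c0 * N%:R ^+ i)).
    rewrite ler_pM2l// -[leLHS]expr1 ler_weXn2l ?ler1n//.
    by case/andP: hi => /ltnW.
  apply: le_trans h2 _.
  apply: (@le_trans _ _ (q%:R ^+ k * D%:R ^+ c * h%:R ^+ k)).
    by rewrite natrM exprMn mulrAC.
  rewrite ler_wpM2r ?exprn_ge0// -!natrX -natrM ler_nat expnD leq_mul2r.
  by apply/orP; right; rewrite expnM; case: (k) => // k'; rewrite leq_exp2r.
have h4 : c0 * ((D ^ (c * k + c))%:R * D%:R) <= c0 * N%:R.
  by rewrite ler_pM2l// -natrM -expnSr ler_nat -addn1.
have /truncn_itv/andP[_] : 0 <= h%:R ^+ k / c0 by rewrite divr_ge0 ?exprn_ge0// ltW.
rewrite -/B ltr_pdivrMr// => h5.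
have h6 : c0 * B.+1%:R <= c0 * D%:R by rewrite ler_pM2l// ler_nat.
have h7 : 0 < (D ^ (c * k + c))%:R :> R by rewrite ltr0n expn_gt0 D0.
have : c0 * D%:R <= h%:R ^+ k.
  rewrite -(ler_pM2l h7); apply: le_trans h3; apply: le_trans h4.
  by rewrite mulrCA.
lra.
Qed.

End Diophantine.

(** * Integrals of trigonometric polynomials *)

Section Integrals.
Local Open Scope classical_set_scope.
Variable R : realType.
Notation mu := (@lebesgue_measure R).
Implicit Types (f g : R -> R) (c x : R).

Lemma lebesgue_measure01 : mu `[0, 1] = 1%E.
Proof. by rewrite lebesgue_measure_itv/= lte_fin ltr01 oppr0 adde0. Qed.

Lemma integrable01 f : continuous f -> mu.-integrable `[0, 1] (EFin \o f).
Proof.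
move=> cf; apply: continuous_compact_integrable; first exact: segment_compact.
exact: continuous_subspaceT.
Qed.

Lemma continuous_big_sum (I : Type) (r : seq I) (P : pred I) (F : I -> R -> R) :
  (forall i, continuous (F i)) -> continuous (fun x => \sum_(i <- r | P i) F i x).
Proof.
move=> cF; elim: r => [|i r IH] x.
  under eq_fun do rewrite big_nil; exact: cvg_cst.
under eq_fun do rewrite big_cons.
by case: (P i); [apply: cvgD; [exact: cF|exact: IH]|exact: IH].
Qed.

Lemma Rintegral_big_sum (I : Type) (r : seq I) (P : pred I) (F : I -> R -> R) :
  (forall i, continuous (F i)) ->
  \int[mu]_(x in `[0, 1]) (\sum_(i <- r | P i) F i x) =
  \sum_(i <- r | P i) \int[mu]_(x in `[0, 1]) F i x.
Proof.
move=> cF; elim: r => [|i r IH].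
  under eq_Rintegral do rewrite big_nil.
  by rewrite Rintegral_cst ?mul0r ?big_nil//; exact: measurable_itv.
rewrite big_cons; under eq_Rintegral do rewrite big_cons.
case: (P i); rewrite -IH// RintegralD//.
- exact: integrable01.
- by apply: integrable01; exact: continuous_big_sum.
Qed.

Lemma is_derive_sin_affine c l x :
  is_derive x 1 (fun x => sin (c + l * x)) (l * cos (c + l * x)).
Proof.
have h : is_derive x 1 (fun x => c + l * x) l.
  have -> : (fun x => c + l * x) = cst c + l *: (@id R) by apply/funext.
  by apply: is_derive_eq; rewrite add0r /GRing.scale/= mulr1.
by rewrite mulrC; exact: (is_derive1_comp (is_derive_sin _) h).
Qed.

Lemma continuous_cos_affine c l : continuous (fun x : R => cos (c + l * x)).
Proof.
move=> x; apply: (@continuous_comp _ _ _ (fun x => c + l * x) cos); last first.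
  exact: continuous_cos.
by apply: cvgD; [exact: cvg_cst|apply: cvgM; [exact: cvg_cst|exact: cvg_id]].
Qed.

Lemma continuous_Re_expi2pi c (l : int) :
  continuous (fun x : R => complex.Re (expi2pi (c + l%:~R * x))).
Proof.
have -> : (fun x : R => complex.Re (expi2pi (c + l%:~R * x))) =
   (fun x => cos (2 * pi * c + (2 * pi * l%:~R) * x)).
  by apply/funext => x /=; rewrite mulrDr mulrA.
exact: continuous_cos_affine.
Qed.

(** For nonzero [l] the primitive sin(2 pi (c + l x)) / (2 pi l) agrees at 0 and 1. *)
Lemma Rintegral_expi2pi c (l : int) :
  \int[mu]_(x in `[0, 1]) complex.Re (expi2pi (c + l%:~R * x)) =
  if l == 0 then complex.Re (expi2pi c) else 0.
Proof.
have [->|l0] := eqVneq l 0.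
  under eq_Rintegral do rewrite mul0r addr0.
  rewrite Rintegral_cst; last exact: measurable_itv.
  by rewrite -[RHS]mulr1; congr (_ * _); exact: (congr1 fine lebesgue_measure01).
pose w : R := 2 * pi * l%:~R.
have w0 : w != 0 by rewrite !mulf_eq0 intr_eq0 (gt_eqF (pi_gt0 R)) pnatr_eq0 (negbTE l0).
pose F x := sin (2 * pi * c + w * x) / w.
have dF x : is_derive x 1 F (cos (2 * pi * c + w * x)).
  have -> : F = (w^-1 \*: (fun x => sin (2 * pi * c + w * x))).
    by apply/funext => y; rewrite /F mulrC.
  have dsin := is_derive_sin_affine (2 * pi * c) w x.
  apply: (@is_derive_eq _ _ _ _ _ _ _ _ (is_deriveZ w^-1 dsin)).
  by rewrite /GRing.scale/= mulKf.
rewrite /Rintegral.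
under eq_integral do rewrite /= mulrDr mulrA -/w.
rewrite (@continuous_FTC2 _ _ F)//.
- rewrite /F -EFinB/= mulr0 addr0 mulr1.
  have : expi2pi (c + l%:~R) = expi2pi c by rewrite expi2piDint.
  by rewrite /expi2pi mulrDr -/w => -[_ ->]; rewrite subrr.
- by apply: continuous_subspaceT; exact: continuous_cos_affine.
- have cF : continuous F.
    by move=> x; apply: differentiable_continuous; apply/derivable1_diffP.
  split=> //.
  + exact/cvg_at_right_filter/cF.
  + exact/cvg_at_left_filter/cF.
- by move=> x _; rewrite derive1E derive_val.
Qed.

End Integrals.

(** * Duality *)

Section Duality.
Local Open Scope classical_set_scope.
Variable R : realType.
Notation mu := (@lebesgue_measure R).
Implicit Types (x : R).

(** If a <= Y b, the second term suffices. Otherwise b = b^(2-p) b^(p-1) <= G^(2-p) (a / Y)^(p-1),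
    which gives the first. *)
Lemma young_split (a b G Y p : R) : 0 <= a -> 0 <= b <= G -> 0 < Y -> 1 <= p <= 2 ->
  a * b <= Y `^ (1 - p) * G `^ (2 - p) * a `^ p + Y * b ^+ 2.
Proof.
move=> a0 /andP[b0 bG] Y0 /andP[p1 p2].
have Yb2 : 0 <= Y * b ^+ 2 by rewrite mulr_ge0 ?sqr_ge0 ?ltW.
have [aYb|Yba] := leP a (Y * b).
  have : a * b <= Y * b * b by rewrite ler_wpM2r.
  rewrite -mulrA -expr2 => h; rewrite (le_trans h)// lerDr.
  by rewrite !mulr_ge0 ?powR_ge0.
have [->|bn0] := eqVneq b 0.
  by rewrite mulr0 addr_ge0// ?mulr_ge0 ?powR_ge0// ?expr0n ltW.
have {}b0 : 0 < b by rewrite lt_def bn0.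
rewrite -[leLHS]addr0 lerD//.
have {}a0 : 0 < a by apply: lt_trans Yba; rewrite mulr_gt0.
have -> : 1 - p = - (p - 1) by rewrite opprB.
rewrite powRN -mulrA ler_pdivlMl ?powR_gt0//.
have -> : b = b `^ (2 - p) * b `^ (p - 1).
  rewrite -powRD ?bn0 ?implybT//.
  have -> : 2 - p + (p - 1) = 1 by ring.
  by rewrite powRr1// ltW.
have -> : Y `^ (p - 1) * (a * (b `^ (2 - p) * b `^ (p - 1))) =
  b `^ (2 - p) * (a * (Y * b) `^ (p - 1)).
  by rewrite (powRM _ (ltW Y0) (ltW b0)); ring.
apply: ler_pM; rewrite ?mulr_ge0 ?powR_ge0 ?(ltW a0)//.
  by rewrite ge0_ler_powR ?subr_ge0 ?nnegrE ?(ltW b0)// (le_trans _ bG)// ltW.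
rewrite -(@mulr_powRB1 _ a p) ?(ltW a0)//; last by rewrite (lt_le_trans ltr01).
rewrite ler_wpM2l ?(ltW a0)// ge0_ler_powR ?subr_ge0 ?nnegrE ?(ltW a0) ?(ltW Yba)//.
by rewrite mulr_ge0 ?ltW.
Qed.

(** The square expands into a finite sum of cosines. *)
Lemma continuous_sqr_cabs_trig (I : finType) (B : {set I}) (phi : I -> R) (l : I -> int) :
  continuous (fun x => cabs (\sum_(i in B) expi2pi (phi i + (l i)%:~R * x)) ^+ 2).
Proof.
have -> : (fun x => cabs (\sum_(i in B) expi2pi (phi i + (l i)%:~R * x)) ^+ 2) =
  (fun x => \sum_(i in B) \sum_(j in B)
     complex.Re (expi2pi (phi i - phi j + (l i - l j)%:~R * x))).
  apply/funext => x; rewrite sqr_cabs_sum; apply: eq_bigr => i _.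
  apply: eq_bigr => j _; congr (complex.Re (expi2pi _)).
  by rewrite intrB; ring.
by do 2 (apply: continuous_big_sum => ?); exact: continuous_Re_expi2pi.
Qed.

Lemma integrable_cabs_trig_powR (I : finType) (B : {set I}) (phi : I -> R)
    (l : I -> int) (p : R) : 0 <= p ->
  mu.-integrable `[0, 1] (EFin \o
    (fun x => cabs (\sum_(i in B) expi2pi (phi i + (l i)%:~R * x)) `^ p)).
Proof.
move=> p0; pose f x := cabs (\sum_(i in B) expi2pi (phi i + (l i)%:~R * x)).
apply: measurable_bounded_integrable.
- exact: measurable_itv.
- apply: (@le_lt_trans _ _ 1%E (mu `[0, 1])); last exact: ltry.
  by rewrite lebesgue_measure01.
- apply: (@measurableT_comp _ _ _ _ _ _ (@powR R ^~ p) _ f).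
    exact: measurable_powR.
  apply: measurable_funTS; apply: continuous_measurable_fun.
  have -> : f = (fun x => Num.sqrt (f x ^+ 2)).
    by apply/funext => x; rewrite sqrtr_sqr ger0_norm// cabs_ge0.
  move=> x; apply: (@continuous_comp _ _ _ (fun x => f x ^+ 2) Num.sqrt).
    exact: continuous_sqr_cabs_trig.
  exact: sqrt_continuous.
- exists (#|B|%:R `^ p); split; first exact: num_real.
  move=> y hy x _ /=; rewrite ger0_norm ?powR_ge0// ltW// (le_lt_trans _ hy)//.
  rewrite ge0_ler_powR ?nnegrE ?cabs_ge0// (le_trans (cabs_sum _ _ _))//.
  rewrite (eq_bigr (fun=> 1)) => [|i _]; first by rewrite sumr_const.
  by rewrite cabs_expi2pi.
Qed.

Lemma parseval N (phi : nat -> R) :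
  \int[mu]_(x in `[0, 1]) (cabs (\sum_(m < N) expi2pi (phi m - m%:R * x)) ^+ 2) = N%:R.
Proof.
pose l (m n : nat) : int := n%:Z - m%:Z.
have -> : (fun x => cabs (\sum_(m < N) expi2pi (phi m - m%:R * x)) ^+ 2) =
  (fun x => \sum_(m < N) \sum_(n < N)
     complex.Re (expi2pi (phi m - phi n + (l m n)%:~R * x))).
  apply/funext => x; rewrite sqr_cabs_sum; apply: eq_bigr => m _.
  apply: eq_bigr => n _; congr (complex.Re (expi2pi _)).
  by rewrite /l intrB; ring.
rewrite Rintegral_big_sum => [|m]; last first.
  by apply: continuous_big_sum => n; exact: continuous_Re_expi2pi.
rewrite (eq_bigr (fun=> 1)); first by rewrite sumr_const card_ord.
move=> m _; rewrite Rintegral_big_sum => [|n]; last exact: continuous_Re_expi2pi.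
rewrite (bigD1 m)//= Rintegral_expi2pi /l subrr eqxx subrr expi2pi0/=.
rewrite big1 ?addr0// => n nm; rewrite Rintegral_expi2pi subr_eq0.
by move: nm; rewrite -val_eqE eqz_nat => /negbTE ->.
Qed.

Lemma Re_mul_sum N (B : {set 'I_N}) (phi : nat -> R) :
  (fun x => complex.Re ((\sum_(n in B) expi2pi (n%:R * x)) *
     \sum_(m < N) expi2pi (phi m - m%:R * x))) =
  (fun x => \sum_(n in B) \sum_(m < N)
     complex.Re (expi2pi (phi m + (n%:Z - m%:Z)%:~R * x))).
Proof.
apply/funext => x; rewrite mulr_suml Re_sum; apply: eq_bigr => n _.
rewrite mulr_sumr Re_sum; apply: eq_bigr => m _; rewrite -expi2piD.
by congr (complex.Re (expi2pi _)); rewrite intrB; ring.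
Qed.

Lemma Re_sum_Rintegral N (B : {set 'I_N}) (phi : nat -> R) :
  \int[mu]_(x in `[0, 1]) complex.Re ((\sum_(n in B) expi2pi (n%:R * x)) *
     \sum_(m < N) expi2pi (phi m - m%:R * x)) =
  complex.Re (\sum_(n in B) expi2pi (phi n)).
Proof.
rewrite Re_mul_sum.
rewrite Rintegral_big_sum => [|n]; last first.
  by apply: continuous_big_sum => m; exact: continuous_Re_expi2pi.
rewrite Re_sum; apply: eq_bigr => n _.
rewrite Rintegral_big_sum => [|m]; last exact: continuous_Re_expi2pi.
rewrite (bigD1 n)//= Rintegral_expi2pi subrr eqxx.
rewrite big1 ?addr0// => m mn; rewrite Rintegral_expi2pi subr_eq0.
by move: mn; rewrite -val_eqE eq_sym eqz_nat => /negbTE ->.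
Qed.

(** The bound [G] concerns the sum over all m < N, which Weyl's inequality controls; the set [B]
    enters only through the mean value. *)
Lemma Re_sum_le N (B : {set 'I_N}) (phi : nat -> R) (p G Y : R) :
  1 <= p <= 2 -> 0 < Y ->
  (forall x, cabs (\sum_(m < N) expi2pi (phi m - m%:R * x)) <= G) ->
  complex.Re (\sum_(n in B) expi2pi (phi n)) <= Y `^ (1 - p) * G `^ (2 - p) *
    \int[mu]_(x in `[0, 1]) (cabs (\sum_(n in B) expi2pi (n%:R * x)) `^ p) + Y * N%:R.
Proof.
move=> p12 Y0 hG; rewrite -Re_sum_Rintegral -(parseval N phi).
pose f x : R := cabs (\sum_(n in B) expi2pi (n%:R * x)).
pose g x : R := cabs (\sum_(m < N) expi2pi (phi m - m%:R * x)).
have p0 : 0 <= p by case/andP: p12 => h _; rewrite (le_trans ler01).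
have m01 : measurable (`[0, 1] : set R) by exact: measurable_itv.
have If : mu.-integrable `[0, 1] (EFin \o (fun x => f x `^ p)).
  have := @integrable_cabs_trig_powR _ B (fun=> 0) (fun n => n%:Z) p p0.
  rewrite (_ : (fun x => _) = (fun x => f x `^ p))//; apply/funext => x.
  by rewrite /f; congr (cabs _ `^ _); apply: eq_bigr => n _; rewrite add0r.
have cg : continuous (fun x => g x ^+ 2).
  have := @continuous_sqr_cabs_trig 'I_N [set: 'I_N]%SET phi (fun m => - m%:Z).
  rewrite (_ : (fun x => _) = (fun x => g x ^+ 2))//; apply/funext => x.
  rewrite /g; congr (cabs _ ^+ _); apply: eq_big => [m|m _]; first by rewrite inE.
  by rewrite intrN mulNr.
have Ig : mu.-integrable `[0, 1] (EFin \o (fun x => g x ^+ 2)) by exact: integrable01.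
have IZ k (h : R -> R) : mu.-integrable `[0, 1] (EFin \o h) ->
    mu.-integrable `[0, 1] (EFin \o (fun x => k * h x)).
  by move=> Ih; exact: (@integrableZl _ _ R mu `[0, 1] (measurable_itv _) k (EFin \o h) Ih).
pose X := Y `^ (1 - p) * G `^ (2 - p).
have -> : X * \int[mu]_(x in `[0, 1]) (f x `^ p) + Y * \int[mu]_(x in `[0, 1]) (g x ^+ 2) =
    \int[mu]_(x in `[0, 1]) (X * f x `^ p + Y * g x ^+ 2).
  rewrite (@RintegralD _ _ R mu `[0, 1] _ _ (measurable_itv _) (IZ X _ If) (IZ Y _ Ig)).
  rewrite (@RintegralZl _ _ R mu `[0, 1] _ X (measurable_itv _) If).
  by rewrite (@RintegralZl _ _ R mu `[0, 1] _ Y (measurable_itv _) Ig).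
apply: le_Rintegral => //.
- apply: integrable01; rewrite Re_mul_sum.
  by do 2 (apply: continuous_big_sum => ?); exact: continuous_Re_expi2pi.
- exact: (@integrableD _ _ R mu `[0, 1] (measurable_itv _) _ _ (IZ X _ If) (IZ Y _ Ig)).
- move=> x _; apply: le_trans (ler_norm _) _; apply: le_trans (Re_le_cabs _) _.
  by rewrite cabsM; apply: young_split => //; rewrite ?cabs_ge0 ?hG.
Qed.

End Duality.

(** * Weyl's criterion *)

Section Fejer.
Local Open Scope classical_set_scope.
Variable R : realType.
Implicit Types (x y rho : R) (L N h : nat) (s : nat -> R).

Lemma expi2pi_eq1 x : expi2pi x = 1 -> x = (nint x)%:~R.
Proof.
move=> x1; have := cabs_expi2piB1_ge (nintP x).
rewrite -mulrNz expi2piDint x1 subrr cabs0 mulrNz.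
rewrite pmulr_rle0// normr_le0 subr_eq0 => /eqP //.
Qed.

Lemma sum_roots_of_unity L (k : int) y : (0 < `|k| < L)%N ->
  \sum_(l < L) expi2pi (k%:~R / L%:R * l%:R + y) = 0.
Proof.
move=> /andP[k0 kL]; have L0 : (0 < L)%N by exact: leq_ltn_trans kL.
have L0' : L%:R != 0 :> R by rewrite pnatr_eq0 -lt0n.
have := geometric_expi2pi (k%:~R / L%:R) y L.
rewrite mulfVK// [k%:~R + y]addrC expi2piDint subrr => /eqP.
rewrite mulf_eq0 => /orP[|/eqP //].
rewrite subr_eq0 => /eqP /expi2pi_eq1; set m := nint _ => /(canRL (mulfVK L0')).
rewrite -[L%:R]/(L%:Z%:~R) -intrM => /eqP; rewrite eqr_int => /eqP km.
move: k0 kL; rewrite km abszM/= => k0.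
by rewrite ltnNge leq_pmull//; move: k0; rewrite muln_gt0 => /andP[].
Qed.

(** For L > 0 the constant Fourier coefficient is 1. *)
Definition fejer L x : R := L%:R^-1 * cabs (\sum_(h < L) expi2pi (h%:R * x)) ^+ 2.

Lemma fejer_ge0 L x : 0 <= fejer L x.
Proof. by rewrite mulr_ge0 ?invr_ge0 ?sqr_ge0. Qed.

Lemma fejerE L x : fejer L x = L%:R^-1 *
  \sum_(h < L) \sum_(h' < L) complex.Re (expi2pi ((h%:Z - h'%:Z)%:~R * x)).
Proof.
rewrite /fejer sqr_cabs_sum; congr (_ * _); apply: eq_bigr => h _.
by apply: eq_bigr => h' _; rewrite -mulrBl intrB.
Qed.

(** Summing over the multiples of 1 / L kills the frequencies k with 0 < |k| < L, which are all the
    nonzero frequencies of the kernel. *)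
Lemma fejer_sum L x : (0 < L)%N ->
  \sum_(l < L) fejer L (x - l%:R / L%:R) = L%:R.
Proof.
move=> L0; have L0' : L%:R != 0 :> R by rewrite pnatr_eq0 -lt0n.
under eq_bigr => l _ do rewrite fejerE.
rewrite -mulr_sumr exchange_big/=.
under eq_bigr => h _ do rewrite exchange_big/=.
rewrite (eq_bigr (fun=> L%:R)).
  by rewrite sumr_const card_ord -[X in _ * X]mulr_natr mulKf.
move=> h _; rewrite (bigD1 h)//=.
under eq_bigr => l _ do rewrite subrr mul0r mulr0 cos0.
rewrite sumr_const card_ord big1 ?addr0// => h' hh'.
pose k : int := h'%:Z - h%:Z.
have -> : \sum_(l < L) cos (2 * pi * ((h%:Z - h'%:Z)%:~R * (x - l%:R / L%:R))) =
  complex.Re (\sum_(l < L) expi2pi (k%:~R / L%:R * l%:R - k%:~R * x)).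
  rewrite Re_sum; apply: eq_bigr => l _ /=; congr (cos (_ * _)).
  by rewrite /k !intrB; ring.
rewrite sum_roots_of_unity// /k; move: hh'; rewrite -val_eqE/=.
by have := ltn_ord h; have := ltn_ord h'; lia.
Qed.

Lemma fejer_le L x rho : 0 < rho -> rho <= `|x| <= 1 - rho ->
  fejer L x <= (L%:R * rho ^+ 2)^-1.
Proof.
move=> rho0 /andP[x1 x2].
have [->|L0] := posnP L; first by rewrite /fejer mul0r !invr0 mul0r.
(* The two-sided hypothesis keeps x at distance [rho] from every integer, not only from 0. *)
have dx : rho <= `|x - (nint x)%:~R|.
  have [->|m0] := eqVneq (nint x) 0; first by rewrite subr0.
  have : 1 <= `|(nint x)%:~R| :> R by rewrite -intr_norm ler1z -gtz0_ge1 normr_gt0.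
  have := ler_distD x (nint x)%:~R 0; rewrite !subr0 distrC; lra.
have h := cabs_geometric_le x 0 L.
have {}h : rho * cabs (\sum_(h < L) expi2pi (h%:R * x)) <= 1.
  apply: le_trans h.
  under [in leRHS]eq_bigr => n _ do rewrite addr0 mulrC.
  by rewrite ler_wpM2r ?cabs_ge0.
rewrite invfM /fejer ler_wpM2l ?invr_ge0// -exprVn.
rewrite ler_sqr ?nnegrE ?cabs_ge0 ?invr_ge0 ?(ltW rho0)//.
by rewrite -[leRHS]mulr1 ler_pdivlMl.
Qed.

Lemma finite_eventually (I : finType) (Q : I -> nat -> Prop) :
  (forall i, exists N0, forall N, (N0 <= N)%N -> Q i N) ->
  exists N0, forall N, (N0 <= N)%N -> forall i, Q i N.
Proof.
move=> /choice[f hf]; exists (\max_i f i)%N => N hN i; apply: hf.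
exact: leq_trans (leq_bigmax i) hN.
Qed.

(* Upper bounds suffice: replacing y by y + 1/2 changes the sign of the sum. *)
Definition weyl_criterion s := forall h y (eps : R), (0 < h)%N -> 0 < eps ->
  exists N0, forall N, (N0 <= N)%N ->
    complex.Re (\sum_(i < N) expi2pi (h%:R * s i + y)) <= eps * N%:R.

Lemma weyl_criterion_int s : weyl_criterion s -> forall (k : int) y (eps : R),
  k != 0 -> 0 < eps -> exists N0, forall N, (N0 <= N)%N ->
    - (eps * N%:R) <= complex.Re (\sum_(i < N) expi2pi (k%:~R * (s i - y))).
Proof.
move=> W k y eps k0 eps0.
wlog : k k0 / (0 < k)%R => [hw|].
  have [kp|kn|ke] := ltgtP k 0; last by rewrite ke eqxx in k0.
    have [||N0 hN0] := hw (- k); rewrite ?oppr_eq0 ?oppr_gt0//.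
    exists N0 => N /hN0; rewrite !Re_sum; congr (_ <= _); apply: eq_bigr => i _.
    by rewrite -[in RHS]/(complex.Re _) /= intrN mulNr mulrN cosN.
  exact: hw.
case: k k0 => // k k0 _.
have [|N0 hN0] := W k (2^-1 - k%:R * y) eps _ eps0; first by rewrite lt0n.
exists N0 => N /hN0; rewrite !Re_sum; rewrite lerNl -sumrN => /(le_trans _); apply.
rewrite le_eqVlt; apply/orP; left; apply/eqP; apply: eq_bigr => i _ /=.
have -> : 2 * pi * (k%:R * s i + (2^-1 - k%:R * y)) =
  2 * pi * (k%:~R * (s i - y)) + pi :> R.
  by rewrite -[(Posz k)%:~R]/(k%:R); field.
by rewrite cosDpi.
Qed.

(** The L diagonal pairs of frequencies give N after division by L. Each of the L^2 pairs is allowed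
    a loss of eps N / L, which amounts to eps N. *)
Lemma fejer_average s L y (eps : R) : weyl_criterion s -> (0 < L)%N -> 0 < eps ->
  exists N0, forall N, (N0 <= N)%N ->
    N%:R * (1 - eps) <= \sum_(i < N) fejer L (s i - y).
Proof.
move=> W L0 eps0; have LR0 : 0 < L%:R :> R by rewrite ltr0n.
have e0 : 0 < eps / L%:R by rewrite divr_gt0.
pose term (p : 'I_L * 'I_L) N : R :=
  \sum_(i < N) complex.Re (expi2pi ((p.1%:Z - p.2%:Z)%:~R * (s i - y))).
have [p|N0 hN0] := @finite_eventually ('I_L * 'I_L)%type
    (fun p N => (if p.1 == p.2 then N%:R else 0) - eps / L%:R * N%:R <= term p N).
  rewrite /term; case: (eqVneq p.1 p.2) => [->|pp].
    exists 0%N => N _; under eq_bigr => i _ do rewrite subrr mul0r expi2pi0/=.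
    by rewrite sumr_const card_ord lerBlDr lerDl mulr_ge0// ltW.
  have [|N0 hN0] := @weyl_criterion_int s W (p.1%:Z - p.2%:Z) y _ _ e0.
    by rewrite subr_eq0 eqz_nat; move: pp; rewrite -val_eqE.
  by exists N0 => N /hN0; rewrite Re_sum sub0r.
exists N0 => N /hN0 {}hN0.
have -> : \sum_(i < N) fejer L (s i - y) =
    L%:R^-1 * \sum_(h < L) \sum_(h' < L) term (h, h') N.
  under eq_bigr => i _ do rewrite fejerE.
  rewrite -mulr_sumr exchange_big/=; congr (_ * _); apply: eq_bigr => h _.
  by rewrite exchange_big.
rewrite ler_pdivlMl//.
apply: (@le_trans _ _ (\sum_(h < L) \sum_(h' < L)
    ((if h == h' then N%:R else 0) - eps / L%:R * N%:R))); last first.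
  by apply: ler_sum => h _; apply: ler_sum => h' _; exact: (hN0 (h, h')).
rewrite (eq_bigr (fun=> N%:R - eps * N%:R)) => [|h _].
  by rewrite sumr_const card_ord -[leRHS]mulr_natl mulrBr mulr1 [eps * _]mulrC.
rewrite big_split/= -big_mkcond/= (big_pred1 h) => [|j]; last by rewrite eq_sym.
rewrite sumr_const card_ord; congr (_ + _).
by rewrite mulNrn -mulr_natr; congr (- _); field; rewrite gt_eqF.
Qed.

(** The average [phi] of the kernels centred at l / L, l in [Lam], is at most 1 everywhere by
    [fejer_sum] and at most [K] outside [E]. Its sum over the sequence is about N |Lam| / L or more,
    so the sequence must visit [E] that often. *)
Lemma fejer_count s L rho (E : pred R) (Lam : {set 'I_L}) (eps : R) :
  weyl_criterion s -> (0 < L)%N -> 0 < rho -> 0 < eps ->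
  (forall i (l : 'I_L), ~~ E (s i) -> l \in Lam ->
    rho <= `|s i - l%:R / L%:R| <= 1 - rho) ->
  exists N0, forall N, (N0 <= N)%N ->
    N%:R * (#|Lam|%:R / L%:R - (L%:R * rho ^+ 2)^-1 - eps) <=
      #|[set i : 'I_N | E (s i)]%SET|%:R.
Proof.
move=> W L0 rho0 eps0 hE; have LR0 : 0 < L%:R :> R by rewrite ltr0n.
have [l|N0 hN0] := @finite_eventually 'I_L
  (fun l N => N%:R * (1 - eps) <= \sum_(i < N) fejer L (s i - l%:R / L%:R)).
  exact: fejer_average.
exists N0 => N /hN0 {}hN0.
pose phi x := L%:R^-1 * \sum_(l in Lam) fejer L (x - l%:R / L%:R).
have LamL : #|Lam|%:R <= L%:R :> R.
  by rewrite ler_nat -[leqRHS]card_ord max_card.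
set K := (L%:R * rho ^+ 2)^-1.
have K0 : 0 <= K by rewrite invr_ge0 mulr_ge0// sqr_ge0.
have h1 (i : 'I_N) : phi (s i) <= (if E (s i) then 1 else 0) + K.
  rewrite /phi ler_pdivrMl//; case: ifPn => Ei.
    apply: (@le_trans _ _ L%:R); last by rewrite mulrDr mulr1 lerDl mulr_ge0.
    rewrite -[leRHS](fejer_sum (s i) L0) [leRHS](bigID (mem Lam))/= lerDl.
    by apply: sumr_ge0 => l _; exact: fejer_ge0.
  rewrite add0r; apply: (@le_trans _ _ (\sum_(l in Lam) K)).
    by apply: ler_sum => l lL; apply: fejer_le => //; exact: hE.
  by rewrite sumr_const -[leLHS]mulr_natl ler_wpM2r.
have h2 : \sum_(i < N) phi (s i) <=
    #|[set i : 'I_N | E (s i)]%SET|%:R + N%:R * K.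
  apply: le_trans (ler_sum _ (fun i _ => h1 i)) _.
  rewrite big_split/= -big_mkcond/= !sumr_const card_ord -[K *+ N]mulr_natl.
  by rewrite lerD2r ler_nat cardsE.
have h3 : N%:R * (#|Lam|%:R / L%:R - eps) <= \sum_(i < N) phi (s i).
  rewrite -mulr_sumr exchange_big/= ler_pdivlMl//.
  apply: (@le_trans _ _ (\sum_(l in Lam) N%:R * (1 - eps))).
    rewrite sumr_const -[leRHS]mulr_natr.
    have -> : L%:R * (N%:R * (#|Lam|%:R / L%:R - eps)) =
       N%:R * (#|Lam|%:R - L%:R * eps) by field; rewrite gt_eqF.
    rewrite -mulrA ler_wpM2l// mulrBl mul1r lerD2l lerN2 mulrC.
    by rewrite ler_wpM2r// ltW.
  by apply: ler_sum => l _; exact: hN0.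
move: h2 h3; rewrite !mulrBr; lra.
Qed.

Lemma card_multiples_itv L (u v : R) : 0 <= u -> v < 1 -> (0 < L)%N ->
  L%:R * (v - u) - 1 <= #|[set l : 'I_L | u <= l%:R / L%:R <= v]%SET|%:R.
Proof.
move=> u0 v1 L0; have LR0 : 0 < L%:R :> R by rewrite ltr0n.
have [vu|uv] := ltP v u.
  apply: (@le_trans _ _ 0); rewrite // subr_le0 (le_trans _ ler01)//.
  by rewrite pmulr_rle0// subr_le0 ltW.
(* The k integers t + 1, ..., t + k all lie in [L u, L v]. *)
pose k := Num.truncn (L%:R * (v - u)); pose t := Num.truncn (L%:R * u).
have /truncn_itv/andP[k1 k2] : 0 <= L%:R * (v - u) by rewrite mulr_ge0// subr_ge0.
have /truncn_itv/andP[t1 t2] : 0 <= L%:R * u by rewrite mulr_ge0.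
rewrite -/k in k1 k2; rewrite -/t in t1 t2.
have le_v (i : 'I_k) : (t.+1 + i)%:R <= L%:R * v.
  apply: (@le_trans _ _ (t%:R + k%:R)); last by move: k1; rewrite mulrBr; lra.
  by rewrite -natrD ler_nat addSn -addnS leq_add2l.
have ltL (i : 'I_k) : (t.+1 + i < L)%N.
  rewrite -(ltr_nat R) (le_lt_trans (le_v i))// -[ltRHS]mulr1 ltr_pM2l//.
apply: (@le_trans _ _ k%:R); first by move: k2; rewrite -[k.+1%:R]natr1; lra.
rewrite ler_nat -[leqLHS]card_ord.
rewrite -(@card_imset _ _ (fun i => Ordinal (ltL i))); last first.
  by move=> i j /(congr1 val)/= /addnI /val_inj.
apply: subset_leq_card; apply/fintype.subsetP => _ /imsetP[i _ ->].
rewrite inE/= ler_pdivlMr// ler_pdivrMr// [u * _]mulrC [v * _]mulrC le_v andbT.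
by rewrite (le_trans (ltW t2))// ler_nat leq_addr.
Qed.

Lemma fractional_part_itv x : 0 <= fractional_part x < 1.
Proof.
rewrite /fractional_part; have := floor_itv x; rewrite intrD => /andP[h1 h2].
by apply/andP; split; lra.
Qed.

Lemma weyl_criterion_fractional_part s :
  weyl_criterion s -> weyl_criterion (fun n => fractional_part (s n)).
Proof.
move=> W h y eps h0 eps0; have [N0 hN0] := W h y eps h0 eps0.
exists N0 => N /hN0; congr (complex.Re _ <= _); apply: eq_bigr => i _.
rewrite -[RHS](expi2piDint _ (h%:Z * Num.floor (s i))); congr expi2pi.
by rewrite /fractional_part intrM -[h%:Z%:~R]/(h%:R); ring.
Qed.

(** [fejer_count] only bounds counts from below; applied to [a, b] and to its complement it gives
    both inequalities. *)
Lemma weyl_equidistributed s : weyl_criterion s -> equidistributed_mod1 s.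
Proof.
move=> /weyl_criterion_fractional_part W a b a0 ab b1.
pose t n := fractional_part (s n).
have t01 n : 0 <= t n < 1 by exact: fractional_part_itv.
apply/cvgrPdist_le => e e0.
(* The larger loss is that of the complement: 4 eps + 2 / L from the nodes, the kernel tail and the
   error of the criterion, in all at most 8 eps. *)
pose eps : R := Num.min (e / 8) 1.
have eps0 : 0 < eps by rewrite lt_min ltr01 divr_gt0.
have eps1 : eps <= 1 by rewrite ge_min lexx orbT.
have epse : 8 * eps <= e by rewrite mulrC -ler_pdivlMr// ge_min lexx.
(* This size makes the kernel tail 1 / (L eps^2) at most eps. *)
have [L L3] : exists L : nat, eps^-1 ^+ 3 <= L%:R.
  exists (Num.truncn (eps^-1 ^+ 3)).+1; apply: ltW.
  by have /truncn_itv/andP[] : 0 <= eps^-1 ^+ 3 by rewrite exprn_ge0 ?invr_ge0 ?ltW.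
have LR0 : 0 < L%:R :> R by apply: lt_le_trans L3; rewrite exprn_gt0 ?invr_gt0.
have L0 : (0 < L)%N by rewrite -(ltr_nat R).
have Leps : 1 <= L%:R * eps ^+ 3.
  by move: L3; rewrite exprVn -[_^-1]mul1r ler_pdivrMr// exprn_gt0.
have K1 : (L%:R * eps ^+ 2)^-1 <= eps.
  rewrite -[X in X <= _]mul1r ler_pdivrMr ?mulr_gt0 ?exprn_gt0//.
  by rewrite mulrCA -exprS.
have K2 : L%:R^-1 <= eps.
  rewrite -[X in X <= _]mul1r ler_pdivrMr// mulrC (le_trans Leps)// ler_wpM2l//.
  by rewrite exprS ler_piMr ?(ltW eps0)// exprn_ile1// ltW.
(* The margins at a and b, and also at 0 and 1, keep the nodes at distance eps modulo 1 from the
   points outside the counted set. *)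
pose Lam1 := [set l : 'I_L | a + eps <= l%:R / L%:R <= b - eps]%SET.
pose Lam2 := [set l : 'I_L | eps <= l%:R / L%:R <= a - eps]%SET.
pose Lam3 := [set l : 'I_L | b + eps <= l%:R / L%:R <= 1 - eps]%SET.
have c1 : L%:R * (b - eps - (a + eps)) - 1 <= #|Lam1|%:R.
  by apply: card_multiples_itv => //; lra.
have c2 : L%:R * (a - eps - eps) - 1 <= #|Lam2|%:R.
  by apply: card_multiples_itv => //; lra.
have c3 : L%:R * (1 - eps - (b + eps)) - 1 <= #|Lam3|%:R.
  by apply: card_multiples_itv => //; lra.
have c23 : #|(Lam2 :|: Lam3)%SET| = (#|Lam2| + #|Lam3|)%N.
  apply/eqP; rewrite (leq_card_setU Lam2 Lam3).2.
  rewrite -setI_eq0; apply/eqP/setP => l; rewrite !inE; apply/negP.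
  by move=> /andP[/andP[_ h1] /andP[h2 _]]; lra.
have [|N1 hN1] := @fejer_count t L eps (fun x => a <= x <= b) Lam1 eps W L0 eps0 eps0.
  move=> i l /negP Ei; rewrite inE => /andP[l1 l2]; have /andP[t0 t1] := t01 i.
  have [tla|tga] := ltP (t i) a; first by rewrite ler0_norm; lra.
  have [tlb|tgb] := leP (t i) b; first by case: Ei; rewrite tga tlb.
  by rewrite ger0_norm; lra.
have [|N2 hN2] := @fejer_count t L eps (fun x => ~~ (a <= x <= b)) (Lam2 :|: Lam3)%SET
    eps W L0 eps0 eps0.
  move=> i l; rewrite negbK => /andP[ta tb]; rewrite !inE.
  by move=> /orP[] /andP[l1 l2]; [rewrite ger0_norm|rewrite ler0_norm]; lra.
exists (maxn 1 (maxn N1 N2)) => // N /=; rewrite !geq_max => /and3P[N0 /hN1 k1 /hN2 k2].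
have NR0 : 0 < N%:R :> R by rewrite ltr0n.
set c := #|_|.
have cN : c%:R + #|[set i : 'I_N | ~~ (a <= t i <= b)]%SET|%:R = N%:R :> R.
  rewrite -natrD; congr _%:R; rewrite -[RHS]card_ord.
  rewrite -(cardsC [set i : 'I_N | a <= t i <= b]%SET) /c; congr (_ + _)%N.
  by apply: eq_card => i; rewrite !inE.
rewrite -/c in k1.
have d1 : b - a - 2 * eps - L%:R^-1 <= #|Lam1|%:R / L%:R.
  rewrite ler_pdivlMr// mulrBl mulVf ?gt_eqF//; lra.
have d2 : 1 - (b - a) - 4 * eps - 2 * L%:R^-1 <= #|(Lam2 :|: Lam3)%SET|%:R / L%:R.
  rewrite c23 natrD ler_pdivlMr// mulrBl -[2 * _ * _]mulrA mulVf ?gt_eqF//; lra.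
have {}k1 : N%:R * (b - a - 8 * eps) <= c%:R.
  by apply: le_trans k1; rewrite ler_pM2l//; lra.
have {}k2 : N%:R * (1 - (b - a) - 8 * eps) <=
    #|[set i : 'I_N | ~~ (a <= t i <= b)]%SET|%:R.
  by apply: le_trans k2; rewrite ler_pM2l//; lra.
have k3 : b - a - 8 * eps <= N%:R^-1 * c%:R by rewrite ler_pdivlMl.
have k4 : N%:R^-1 * c%:R <= b - a + 8 * eps.
  rewrite ler_pdivrMl//; move: k2; rewrite -cN; set c' := _%:R; lra.
by rewrite ler_norml; lra.
Qed.

End Fejer.

(** * Conclusion *)

Section Subconvex.
Local Open Scope classical_set_scope.
Variable R : realType.
Implicit Types (p : R) (a : nat -> nat).

(** Choosing N = a n makes A(N) a prefix of the sequence, with n + 1 terms. *)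
Lemma big_initial_range a n (V : nmodType) (F : nat -> V) :
  {homo a : m n / (m < n)%N} -> ~ range a 0%N ->
  \sum_(m in initial (range a) (a n)) F m = \sum_(i < n.+1) F (a i).
Proof.
move=> a_incr a0; have a_mono := leq_mono a_incr.
have ltb (i : 'I_n.+1) : (a i < (a n).+1)%N by rewrite ltnS a_mono -ltnS.
pose b (i : 'I_n.+1) := Ordinal (ltb i).
have b_inj : injective b.
  move=> i j /(congr1 val)/= aij; apply/val_inj/eqP.
  by rewrite eqn_leq -(a_mono i j) -(a_mono j i) aij leqnn.
rewrite -[RHS](big_imset (fun m : 'I_(a n).+1 => F m) (h := b)); last first.
  by move=> i j _ _; exact: b_inj.
apply: eq_bigl => m; rewrite inE; apply/andP/imsetP => [[m0 /set_mem[j _ ajm]]|[i _ ->]].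
  have jn : (j < n.+1)%N by rewrite ltnS -a_mono ajm -ltnS.
  by exists (Ordinal jn) => //; apply/val_inj; rewrite /= ajm.
split; last by apply/mem_set; exists i.
by rewrite lt0n; apply/eqP => ai0; apply: a0; exists i.
Qed.

Lemma card_initial_range a n : {homo a : m n / (m < n)%N} -> ~ range a 0%N ->
  #|initial (range a) (a n)| = n.+1.
Proof.
move=> a_incr a0; rewrite -sum1_card (big_initial_range n (fun=> 1%N) a_incr a0).
by rewrite sum_nat_const card_ord muln1.
Qed.

Lemma ge_powR_eventually (tau Q : R) : 0 < tau ->
  exists D1 : nat, forall D : nat, (D1 <= D)%N -> Q <= D%:R `^ tau.
Proof.
move=> tau0; exists (Num.truncn (`|Q| `^ tau^-1)).+1 => D hD.
apply: le_trans (ler_norm Q) _.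
rewrite -[leLHS]powRr1// -[X in _ `^ X <= _](mulVf (lt0r_neq0 tau0)) powRrM.
rewrite ge0_ler_powR ?(ltW tau0) ?nnegrE ?powR_ge0//.
have /truncn_itv/andP[_ /ltW h] := powR_ge0 `|Q| tau^-1.
by rewrite (le_trans h)// ler_nat.
Qed.

(** [D] is the integer part of N^(1/s). The last clause measures the N^eps loss of subconvexity
    against powers of [D]. *)
Lemma truncn_root (s N D2 : nat) : (0 < s)%N -> (D2 ^ s <= N)%N ->
  exists D : nat, [/\ (D2 <= D)%N, (D ^ s <= N)%N &
    forall tau : R, 0 <= tau -> N%:R `^ (tau / s%:R) <= D.+1%:R `^ tau].
Proof.
move=> s0 D2N; pose r : R := N%:R `^ s%:R^-1.
have s0' : s%:R != 0 :> R by rewrite pnatr_eq0 -lt0n.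
have rs : r ^+ s = N%:R.
  by rewrite -powR_mulrn ?powR_ge0// /r -powRrM mulVf// powRr1.
have /truncn_itv/andP[D1 D2'] : 0 <= r by exact: powR_ge0.
exists (Num.truncn r); split.
- rewrite -ltnS -(ltr_nat R) (le_lt_trans _ D2')//.
  by rewrite -(@ler_pXn2r _ s) ?nnegrE ?powR_ge0// rs -natrX ler_nat.
- by rewrite -(ler_nat R) natrX -rs ler_pXn2r ?nnegrE ?powR_ge0.
- move=> tau tau0; rewrite mulrC powRrM ge0_ler_powR// ?nnegrE ?powR_ge0//.
  exact: ltW.
Qed.

(** The powers of n combine to n and those of N + 1 to N + 1, at most 2 N. With N^(tau/s) <= 2 D^tau
    there remains eta n times 4 eta^(-p) C / D^tau: half of the saving D^(2 tau) pays for the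
    subconvexity loss, the other half for the constants. *)
Lemma powR_estimate (p eta C n N D s : R) : 1 <= p < 2 -> 0 < eta -> 0 <= C ->
  0 < n -> 1 <= N -> 1 <= D -> 0 < s ->
  N `^ ((2 - p) / 2 / s) <= (D + 1) `^ ((2 - p) / 2) ->
  4 * eta `^ (- p) * C <= D `^ ((2 - p) / 2) ->
  (eta * n / (N + 1)) `^ (1 - p) * ((N + 1) / D) `^ (2 - p) *
    (C * (N `^ ((2 - p) / 2 / s - 1) * n `^ p)) <= eta * n.
Proof.
move=> /andP[p1 p2] eta0 C0 n0 N1 D1 s0; set tau := (2 - p) / 2.
have tau0 : 0 < tau by rewrite divr_gt0// subr_gt0.
have tau1 : tau <= 1 by rewrite /tau; lra.
have N0 : 0 < N by exact: lt_le_trans N1.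
have D0 : 0 < D by exact: lt_le_trans D1.
have T0 : 0 < N + 1 by rewrite addr_gt0.
have pw0 x e : 0 < x -> 0 < x `^ e :> R by exact: powR_gt0.
have pwne x e : 0 < x -> x `^ e != 0 :> R by move=> x0; rewrite gt_eqF// powR_gt0.
move=> hN hD.
have e2p : 2 - p = tau + tau by rewrite /tau; field.
have E1 : (eta * n / (N + 1)) `^ (1 - p) * (n `^ p * (N + 1) `^ (2 - p)) =
    eta * eta `^ (- p) * n * (N + 1).
  have e1 : eta `^ (1 - p) = eta * eta `^ (- p).
    by rewrite powRD ?powRr1 ?ltW// (gt_eqF eta0) implybT.
  have e2 : n `^ (1 - p) * n `^ p = n.
    by rewrite -powRD ?(gt_eqF n0) ?implybT// subrK powRr1// ltW.
  have e3 : (N + 1)^-1 `^ (1 - p) * (N + 1) `^ (2 - p) = N + 1.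
    rewrite -powR_inv1 ?ltW// -powRrM -powRD ?(gt_eqF T0) ?implybT//.
    have -> : -1 * (1 - p) + (2 - p) = 1 by ring.
    by rewrite powRr1// ltW.
  rewrite powRM ?mulr_ge0 ?invr_ge0 ?ltW// powRM ?ltW// e1.
  transitivity (eta * eta `^ (- p) * (n `^ (1 - p) * n `^ p) *
    ((N + 1)^-1 `^ (1 - p) * (N + 1) `^ (2 - p))); last by rewrite e2 e3.
  ring.
have E2 : N `^ (tau / s - 1) = N `^ (tau / s) / N.
  by rewrite powRB ?powRr1 ?ltW// (gt_eqF N0) implybT.
have E3 : ((N + 1) / D) `^ (2 - p) = (N + 1) `^ (2 - p) / (D `^ tau * D `^ tau).
  rewrite powRM ?invr_ge0 ?ltW//; congr (_ * _).
  rewrite -powR_inv1 ?ltW// -powRrM mulN1r powRN; congr (_^-1).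
  by rewrite -powRD ?(gt_eqF D0) ?implybT// e2p.
have h2D : (D + 1) `^ tau <= 2 * D `^ tau.
  apply: (@le_trans _ _ ((2 * D) `^ tau)).
    by rewrite ge0_ler_powR ?nnegrE ?(ltW tau0) ?mulr_ge0 ?addr_ge0 ?(ltW D0)//; lra.
  rewrite powRM ?(ltW D0)// ler_wpM2r ?powR_ge0//.
  by apply: ler1_powR => //; rewrite ler1n.
have Dt0 := pw0 D tau D0.
rewrite E3 E2.
have -> : (eta * n / (N + 1)) `^ (1 - p) * ((N + 1) `^ (2 - p) / (D `^ tau * D `^ tau)) *
    (C * (N `^ (tau / s) / N * n `^ p)) =
  (eta * n / (N + 1)) `^ (1 - p) * (n `^ p * (N + 1) `^ (2 - p)) *
  (C * N `^ (tau / s)) / (N * (D `^ tau * D `^ tau)).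
  by field; rewrite !gt_eqF.
rewrite E1 ler_pdivrMr ?mulr_gt0//.
have h1 : C * N `^ (tau / s) <= C * (2 * D `^ tau).
  by rewrite ler_wpM2l// (le_trans hN).
have h3 : (4 * eta `^ (- p) * C) * D `^ tau <= D `^ tau * D `^ tau.
  by rewrite ler_pM2r.
have e0 := pw0 eta (- p) eta0.
apply: (@le_trans _ _ (eta * eta `^ (- p) * n * (2 * N) * (C * (2 * D `^ tau)))).
  apply: ler_pM => //.
  - by rewrite !mulr_ge0 ?ltW.
  - by rewrite mulr_ge0 ?powR_ge0.
  - by rewrite ler_pM2l ?mulr_gt0//; lra.
have -> : eta * eta `^ (- p) * n * (2 * N) * (C * (2 * D `^ tau)) =
  eta * n * N * ((4 * eta `^ (- p) * C) * D `^ tau) by ring.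
by rewrite -[leRHS]mulrA [leRHS]mulrA [leRHS]mulrA ler_pM2l ?mulr_gt0.
Qed.

End Subconvex.

Theorem theorem6p1 (R : realType) (p : R) (A : set nat) (a : nat -> nat)
    (k : nat) (alpha : 'I_k.+1 -> R) :
  {homo a : m n / (m < n)%N} ->
  A = range a ->
  weakly_subconvex p A ->
  1 <= p < 2 ->
  (2 <= k)%N ->
  (exists2 i : 'I_k.+1, (2 <= i)%N & finite_diophantine_type (alpha i)) ->
  equidistributed_mod1
    (fun n : nat => \sum_(i < k.+1) alpha i * (a n)%:R ^+ i).
Proof.
move=> a_incr -> [_ _ a0 subconvex] p12 k2 [i i2 dioph].
apply: weyl_equidistributed => h y eps h0 eps0.
case: k alpha k2 i i2 dioph => // d alpha d1 i i2 dioph.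
pose P : {poly R} := \poly_(j < d.+2) alpha (inord j).
have PE n : P.[n%:R] = \sum_(j < d.+2) alpha j * n%:R ^+ j.
  rewrite horner_poly; apply: eq_bigr => j _.
  by rewrite inord_val.
have Pi : P`_i = alpha i by rewrite coef_poly ltn_ord inord_val.
have [||||s [D0 hD0]] := @weyl_sum_bound R d P i h.
- exact: size_poly.
- by rewrite i2 /= -ltnS ltn_ord.
- by rewrite Pi.
- exact: h0.
(* Each of the two terms of [Re_sum_le] is allowed [eta] per element of A(N). *)
pose tau := (2 - p) / 2; pose eta := eps / 2.
have tau0 : 0 < tau by rewrite /tau; lra.
have eta0 : 0 < eta by rewrite divr_gt0.
have sR0 : 0 < s.+1%:R :> R by rewrite ltr0n.
have [C [N1 _ hC]] := subconvex (tau / s.+1%:R) (divr_gt0 tau0 sR0).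
have [D1 hD1] := @ge_powR_eventually R tau (4 * eta `^ (- p) * `|C|) tau0.
pose D2 := maxn 1 (maxn D0 D1).
(* The criterion is tested on n + 1 terms; as a n >= n, all thresholds on N hold for large n. *)
exists (maxn N1 (D2 ^ s.+1)).+1 => -[//|n]; rewrite ltnS geq_max => /andP[N1n D2n].
pose N := a n.
have nN : (n <= N)%N.
  by rewrite /N; elim: (n) => // m IH; exact: leq_ltn_trans IH (a_incr _ _ (ltnSn m)).
have N0 : (0 < N)%N by rewrite lt0n; apply/eqP => N0; apply: a0; exists n.
have [D [D2D DN hD]] := @truncn_root R s.+1 N D2 isT (leq_trans D2n nN).
move: D2D; rewrite !geq_max => /and3P[Dgt0 D0D D1D].
pose phi m := h%:R * P.[m%:R] + y.
have -> : \sum_(j < n.+1)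
      expi2pi (h%:R * (\sum_(l < d.+2) alpha l * (a j)%:R ^+ l) + y) =
    \sum_(m in initial (range a) N) expi2pi (phi m).
  rewrite (big_initial_range n (fun m => expi2pi (phi m)) a_incr a0).
  by apply: eq_bigr => j _; rewrite /phi PE.
have DR0 : 0 < D%:R :> R by rewrite ltr0n.
(* The term - m x only alters the linear coefficient, in which [weyl_sum_bound] is uniform, and y
   gives a unimodular factor. *)
have hG x : cabs (\sum_(m < N.+1) expi2pi (phi m - m%:R * x)) <= N.+1%:R / D%:R.
  have -> : \sum_(m < N.+1) expi2pi (phi m - m%:R * x) =
      expi2pi y * weyl_sum (h%:R *: P + (- x) *: 'X) N.+1.
    rewrite mulr_sumr; apply: eq_bigr => m _; rewrite -expi2piD; congr expi2pi.
    by rewrite /phi hornerD !hornerZ hornerX; ring.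
  rewrite cabsM cabs_expi2pi mul1r ler_pdivlMr// mulrC; apply: hD0 => //.
  by rewrite (leq_trans _ (leqW DN))// leq_pexp2l.
have Y0 : 0 < eta * n.+1%:R / N.+1%:R by rewrite divr_gt0 ?mulr_gt0 ?ltr0n.
have p12' : 1 <= p <= 2 by lra.
apply: le_trans (Re_sum_le (initial (range a) N) p12' Y0 hG) _.
rewrite divfK ?pnatr_eq0//.
have -> : eps * n.+1%:R = eta * n.+1%:R + eta * n.+1%:R by rewrite /eta; field.
rewrite lerD2r.
have := hC N (leq_trans N1n nN); rewrite card_initial_range// => hmean.
(* The sign of [C] is unknown, so |C| replaces it. *)
apply: (@le_trans _ _ ((eta * n.+1%:R / N.+1%:R) `^ (1 - p) *
  (N.+1%:R / D%:R) `^ (2 - p) *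
  (`|C| * (N%:R `^ (tau / s.+1%:R - 1) * n.+1%:R `^ p)))).
  rewrite ler_wpM2l ?mulr_ge0 ?powR_ge0//; apply: le_trans hmean _.
  by rewrite ler_wpM2r ?mulr_ge0 ?powR_ge0// ler_norm.
rewrite -[N.+1%:R]natr1; apply: powR_estimate => //.
- by rewrite ler1n.
- by rewrite ler1n.
- by rewrite natr1; apply: hD; exact: ltW.
- exact: hD1.
Qed.
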